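(* Let $a>0$ be a constant. For $x_0\in C^2([0,1])$, let $\Phi(x_0)\subseteq C^0(\mathbb{R}_+;\mathbb{R}^2)$ be the non-empty set of pairs $(d_0,d_1)$ for which the evolution equation $$\frac{\partial x}{\partial t}(t,z)=a\frac{\partial^2x}{\partial z^2}(t,z)\quad\text{for }(t,z)\in(0,+\infty)\times(0,1),$$ with $x(t,0)=d_0(t)$, $x(t,1)=d_1(t)$ for $t\ge0$ and initial condition $x_0$ has a unique solution $x\in C^0(\mathbb{R}_+\times[0,1])\cap C^1((0,+\infty)\times[0,1])$ with $x[t]\in C^2([0,1])$ for all $t\ge0$ and $x(0,z)=x_0(z)$ for all $z\in[0,1]$. Then for every $x_0\in C^2([0,1])$ and $(d_0,d_1)\in\Phi(x_0)$, this unique solution satisfies the following estimates for all $t\ge0$: $$\int_0^1\sin(\pi z)|x(t,z)|dz\le e^{-a\pi^2t}\int_0^1\sin(\pi z)|x(0,z)|dz+\frac1\pi\left(\max_{0\le s\le t}|d_0(s)|+\max_{0\le s\le t}|d_1(s)|\right),$$ $$\sqrt{\int_0^1x^2(t,z)dz}\le\sqrt{\frac{e^{-a\pi^2t}}{2-e^{-a\pi^2t}}}\sqrt{\int_0^1x^2(0,z)dz}+\frac1{\sqrt3}\left(\max_{0\le s\le t}|d_0(s)|+\max_{0\le s\le t}|d_1(s)|\right),$$ and, for all $\sigma\in(0,a\pi^2)$ and all $\theta\in(0,\pi-\varphi)$, where $\varphi:=\sqrt{\sigma/a}$, $$\max_{0\le z\le1}\left(\frac{\sin(\theta+\varphi)|x(t,z)|}{\sin(\theta+z\varphi)}\right)\le\max\left(e^{-\sigma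 t}\max_{0\le z\le1}\left(\frac{\sin(\theta+\varphi)|x(0,z)|}{\sin(\theta+z\varphi)}\right),\ \frac{\sin(\theta+\varphi)}{\sin(\theta)}\max_{0\le s\le t}|d_0(s)|,\ \max_{0\le s\le t}|d_1(s)|\right).$$
   Context: $\mathbb{R}_+=[0,+\infty)$. For a function $x$ on $\mathbb{R}_+\times[0,1]$, $x[t]$ denotes the profile $z\mapsto x(t,z)$. *)

(* Defs.v *)
From Stdlib Require Import Reals Lra.
From Coquelicot Require Import Coquelicot.
Open Scope R_scope.

(** Functions on subsets of [R] or [R * R] are total functions of which only
    the values on the subset matter; continuity and differentiability are
    relative to the subset, hence one-sided at endpoints. *)

Definition unit_itv (z : R) : Prop := 0 <= z <= 1.

(** [D_in f f1 D z] says that [f1 z] is the derivative of the restriction of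
    [f] to [D] at [z]. *)
Definition C2_unit (f : R -> R) : Prop :=
  exists f1 f2 : R -> R,
    (forall z, unit_itv z -> D_in f f1 unit_itv z) /\
    (forall z, unit_itv z -> D_in f1 f2 unit_itv z) /\
    continuous_on unit_itv f2.

Definition C0_halfline (d : R -> R) : Prop :=
  continuous_on (fun t => 0 <= t) d.

Definition C0_on (D : R * R -> Prop) (x : R -> R -> R) : Prop :=
  continuous_on D (fun p : R * R => x (fst p) (snd p)).

Definition closed_strip (p : R * R) : Prop := 0 <= fst p /\ unit_itv (snd p).
Definition positive_strip (p : R * R) : Prop := 0 < fst p /\ unit_itv (snd p).

Definition C1_positive_strip (x : R -> R -> R) : Prop :=
  exists xt xz : R -> R -> R,
    (forall t z, 0 < t -> unit_itv z ->
       is_derive (fun s => x s z) t (xt t z)) /\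
    (forall t z, 0 < t -> unit_itv z ->
       D_in (x t) (xz t) unit_itv z) /\
    C0_on positive_strip xt /\
    C0_on positive_strip xz.

Definition heat_solution
    (a : R) (x0 d0 d1 : R -> R) (x : R -> R -> R) : Prop :=
  C0_on closed_strip x /\
  C1_positive_strip x /\
  (forall t, 0 <= t -> C2_unit (x t)) /\
  (forall t z, 0 < t -> 0 < z < 1 ->
     Derive (fun s => x s z) t = a * Derive_n (x t) 2 z) /\
  (forall t, 0 <= t -> x t 0 = d0 t) /\
  (forall t, 0 <= t -> x t 1 = d1 t) /\
  (forall z, unit_itv z -> x 0 z = x0 z).

(** [Phi a x0 d0 d1] is (d0, d1) \in Phi(x0); uniqueness is that of the
    restriction to [closed_strip]. *)
Definition Phi (a : R) (x0 d0 d1 : R -> R) : Prop :=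
  C0_halfline d0 /\ C0_halfline d1 /\
  exists x, heat_solution a x0 d0 d1 x /\
    forall y, heat_solution a x0 d0 d1 y ->
      forall t z, 0 <= t -> unit_itv z -> y t z = x t z.

(** The maximum of [f] on [a, b], as a least upper bound; by
    [max_itv_attained] it is a genuine maximum when [f] is continuous. *)
Definition max_itv (a b : R) (f : R -> R) : R :=
  real (Lub_Rbar (fun y => exists s, a <= s <= b /\ y = f s)).

Lemma max_itv_attained (a b : R) (f : R -> R) :
  a <= b -> continuous_on (fun s => a <= s <= b) f ->
  exists m, a <= m <= b /\ f m = max_itv a b f /\
    forall s, a <= s <= b -> f s <= max_itv a b f.
Proof.
intros Hab Hf.
set (c := fun s => Rmax a (Rmin b s)).
assert (Hc : forall s, a <= c s <= b).
{ intros s; unfold c, Rmax, Rmin; repeat destruct (Rle_dec _ _); lra. }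
assert (Hid : forall s, a <= s <= b -> c s = s).
{ intros s Hs; unfold c, Rmax, Rmin; repeat destruct (Rle_dec _ _); lra. }
assert (Hlip : forall s u, Rabs (c u - c s) <= Rabs (u - s)).
{ intros s u; unfold c, Rmax, Rmin, Rabs;
  repeat destruct (Rle_dec _ _); repeat destruct (Rcase_abs _); lra. }
assert (Hg : forall s, a <= s <= b -> continuity_pt (fun u => f (c u)) s).
{ intros s Hs; apply continuity_pt_filterlim; rewrite (Hid s Hs).
  intros P HP; specialize (Hf s Hs P HP).
  unfold filtermap, within in Hf |- *.
  destruct Hf as [e He]; exists e; intros u Hu.
  apply He; [ | apply Hc ].
  change (Rabs (u - s) < e) in Hu; change (Rabs (c u - s) < e).
  rewrite <- (Hid s Hs) at 1.
  apply Rle_lt_trans with (1 := Hlip s u), Hu. }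
destruct (continuity_ab_maj _ a b Hab Hg) as [m [Hm Hmab]].
assert (Hle : forall s, a <= s <= b -> f s <= f m).
{ intros s Hs; generalize (Hm s Hs); now rewrite (Hid s Hs), (Hid m Hmab). }
assert (E : f m = max_itv a b f).
{ unfold max_itv; rewrite (is_lub_Rbar_unique _ (f m)); [easy | split].
  - intros y [s [Hs ->]]; apply Hle, Hs.
  - intros y Hy; apply Hy; now exists m. }
exists m; rewrite <- E; now split.
Qed.

(* Main.v *)
Require Import Defs.
From Stdlib Require Import Reals Lra.
From Coquelicot Require Import Coquelicot.
Open Scope R_scope.

(** All three estimates come from energies [E s], the integrals over [0, 1] of
    [m (z) eta (u (s, z))] with [eta] convex and [C ^ 2]. Along a solution,
    [E' = a * int m eta'(u) u_zz], and the integrand is compared with the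
    [z]-derivative of an explicit [G] ([energy_rate_le]); this gives
    [E' <= b - c E], hence exponential decay ([energy_decay]).

    For the first estimate, [m = sin (PI z)] is the first Dirichlet
    eigenfunction and [eta] is a smoothing of the absolute value: integrating
    by parts twice gives [c = a PI ^ 2], and the boundary values enter through
    [m' = PI] and [- PI] at the endpoints ([sine_weighted_L1_decay]).

    The two others rest on [pos_part_L2_decay]: if a solution [u] is
    nonpositive at [z = 0] and [z = 1], the square integral of its positive
    part decays with rate [2 a PI ^ 2]. Here [m = 1] and [eta] approximates
    half the square of the positive part; the Poincare inequality is replaced
    by a completed square, with [q = phi cot (theta + phi z)] solving the
    Riccati equation [q' = - phi ^ 2 - q ^ 2] and [phi] tending to [PI].

    For the second estimate this is applied to [u - l] and [- u - l], where
    [l] is the affine, hence stationary, solution with boundary values the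
    maxima of the boundary data. Then [|u| <= w + l], with [w] the positive
    part of [|u| - l], whose norm decays like [exp (- a PI ^ 2 t)], and the
    norm of [l] is at most [(M0 + M1) / sqrt 3].

    The third one is a maximum principle ([caloric_nonpos], the case of
    vanishing initial positive part), applied to [u - v] and [- u - v] with
    the barrier [v = K exp (sigma (t - s)) sin (theta + z phi)]. It solves the
    equation since [sigma = a phi ^ 2], and [K] is chosen to make [v] at the
    final time [t] equal to the asserted bound. *)

(** * Calculus on an interval *)

Lemma ex_RInt_continuity (f : R -> R) (a b : R) :
  (forall z, continuity_pt f z) -> ex_RInt f a b.
Proof.
intros Hf; apply (ex_RInt_continuous (V := R_CompleteNormedModule)).
intros z _; apply continuity_pt_filterlim, Hf.
Qed.

Lemma is_derive_continuity_pt (f : R -> R) (x l : R) :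
  is_derive f x l -> continuity_pt f x.
Proof.
intros H; apply derivable_continuous_pt; exists l; now apply is_derive_Reals.
Qed.

Lemma exp_le_compat (x y : R) : x <= y -> exp x <= exp y.
Proof.
intros [H | ->]; [left; now apply exp_increasing | apply Rle_refl].
Qed.

Lemma is_derive_eq (f : R -> R) (x l k : R) :
  is_derive f x l -> l = k -> is_derive f x k.
Proof. now intros H <-. Qed.

Lemma is_derive_prod (f g : R -> R) (x lf lg : R) :
  is_derive f x lf -> is_derive g x lg ->
  is_derive (fun y => f y * g y) x (lf * g x + f x * lg).
Proof.
intros Hf Hg; apply (is_derive_mult (K := R_AbsRing) f g); try easy.
intros; apply Rmult_comm.
Qed.

Lemma is_derive_sub (f g : R -> R) (x lf lg : R) :
  is_derive f x lf -> is_derive g x lg ->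
  is_derive (fun y => f y - g y) x (lf - lg).
Proof. apply (is_derive_minus (V := R_NormedModule)). Qed.

Lemma RInt_add (f g : R -> R) (a b : R) :
  ex_RInt f a b -> ex_RInt g a b ->
  RInt (fun z => f z + g z) a b = RInt f a b + RInt g a b.
Proof. apply (RInt_plus (V := R_CompleteNormedModule)). Qed.

Lemma RInt_mulc (f : R -> R) (c a b : R) :
  ex_RInt f a b -> RInt (fun z => c * f z) a b = c * RInt f a b.
Proof. apply (RInt_scal (V := R_CompleteNormedModule)). Qed.

Lemma RInt_cst (c a b : R) : RInt (fun _ => c) a b = c * (b - a).
Proof. rewrite RInt_const; apply Rmult_comm. Qed.

Lemma is_derive_primitive (f : R -> R) :
  (forall z, continuity_pt f z) ->
  forall a z, is_derive (fun y => RInt f a y) z (f z).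
Proof.
intros Hf a z.
apply (is_derive_RInt (V := R_NormedModule) f _ a z).
- exists (mkposreal 1 Rlt_0_1); intros y _.
  apply (RInt_correct (V := R_CompleteNormedModule)).
  now apply ex_RInt_continuity.
- now apply continuity_pt_filterlim.
Qed.

Lemma continuity_pt_Rmax (f : R -> R) (c z : R) :
  continuity_pt f z -> continuity_pt (fun y => Rmax c (f y)) z.
Proof.
intros Hf e He; destruct (Hf e He) as [d [Hd H]].
exists d; split; [easy | intros y Hy; specialize (H y Hy)].
revert H; simpl; unfold Rdist.
unfold Rmax, Rabs; repeat destruct (Rle_dec _ _);
  repeat destruct (Rcase_abs _); lra.
Qed.

Lemma continuity_pt_Rmin (f : R -> R) (c z : R) :
  continuity_pt f z -> continuity_pt (fun y => Rmin c (f y)) z.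
Proof.
intros Hf e He; destruct (Hf e He) as [d [Hd H]].
exists d; split; [easy | intros y Hy; specialize (H y Hy)].
revert H; simpl; unfold Rdist.
unfold Rmin, Rabs; repeat destruct (Rle_dec _ _);
  repeat destruct (Rcase_abs _); lra.
Qed.

Lemma le_of_derive_ge0 (f df : R -> R) (a b : R) :
  a <= b ->
  (forall x, a < x < b -> is_derive f x (df x)) ->
  (forall x, a <= x <= b -> continuity_pt f x) ->
  (forall x, a < x < b -> 0 <= df x) ->
  f a <= f b.
Proof.
intros Hab Hd Hc Hp.
(* The mean value may be located at an endpoint, where [df] is arbitrary:
   its positive part has the same values inside and the right sign outside. *)
destruct (MVT_gen f a b (fun x => Rmax 0 (df x))) as [c [_ E]].
- rewrite Rmin_left, Rmax_right by easy; intros x Hx.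
  rewrite Rmax_right by now apply Hp.
  now apply Hd.
- rewrite Rmin_left, Rmax_right by easy; exact Hc.
- assert (0 <= Rmax 0 (df c) * (b - a)); [ | lra].
  apply Rmult_le_pos; [apply Rmax_l | lra].
Qed.

(** Fundamental theorem of calculus for a [G] which is differentiable only
    inside the interval, as are the functions of a solution up to the
    boundary. *)
Lemma RInt_le_increment (G g f : R -> R) (a b : R) :
  a <= b ->
  (forall z, continuity_pt f z) ->
  (forall z, a <= z <= b -> continuity_pt G z) ->
  (forall z, a < z < b -> is_derive G z (g z)) ->
  (forall z, a < z < b -> f z <= g z) ->
  RInt f a b <= G b - G a.
Proof.
intros Hab Hf HG Hd Hle.
set (H := fun z => G z - RInt f a z).
assert (HH : H a <= H b).
{ apply (le_of_derive_ge0 H (fun z => g z - f z)); [easy | | | ].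
  - intros x Hx; unfold H.
    apply is_derive_sub.
    + now apply Hd.
    + now apply is_derive_primitive.
  - intros x Hx; unfold H; apply continuity_pt_minus; [now apply HG | ].
    exact (is_derive_continuity_pt _ _ _ (is_derive_primitive f Hf a x)).
  - intros x Hx; specialize (Hle x Hx); lra. }
unfold H in HH; rewrite RInt_point in HH; unfold zero in HH; simpl in HH.
lra.
Qed.

Lemma gronwall (E dE : R -> R) (c b T : R) :
  c <> 0 -> 0 <= T ->
  (forall s, 0 <= s <= T -> continuity_pt E s) ->
  (forall s, 0 < s < T -> is_derive E s (dE s)) ->
  (forall s, 0 < s < T -> dE s <= b - c * E s) ->
  E T <= exp (- (c * T)) * E 0 + b / c * (1 - exp (- (c * T))).
Proof.
intros Hc HT HE Hd Hle.
set (H := fun s => - (exp (c * s) * (E s - b / c))).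
assert (HH : H 0 <= H T).
{ apply (le_of_derive_ge0 H
    (fun s => exp (c * s) * (b - c * E s - dE s))); [easy | | | ].
  - intros s Hs; unfold H.
    auto_derive.
    + exists (dE s); now apply Hd.
    + assert (U : Derive (fun x => E x) s = dE s)
        by now apply is_derive_unique, Hd.
      rewrite U; field; easy.
  - intros s Hs; unfold H.
    apply continuity_pt_opp, continuity_pt_mult.
    + apply (is_derive_continuity_pt _ _ (c * exp (c * s))).
      auto_derive; [easy | ring].
    + apply continuity_pt_minus; [now apply HE | ].
      apply continuity_pt_const; now intros u v.
  - intros s Hs; apply Rmult_le_pos; [left; apply exp_pos | ].
    specialize (Hle s Hs); lra. }
unfold H in HH; rewrite Rmult_0_r, exp_0 in HH.
assert (P := exp_pos (- (c * T))).
assert (Q : exp (- (c * T)) * exp (c * T) = 1).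
{ rewrite <- exp_plus, <- exp_0; f_equal; ring. }
apply Rmult_le_compat_l with (r := exp (- (c * T))) in HH; [ | lra].
replace (exp (- (c * T)) * - (exp (c * T) * (E T - b / c)))
  with (- ((exp (- (c * T)) * exp (c * T)) * (E T - b / c))) in HH by ring.
rewrite Q in HH; lra.
Qed.

(** * Integrals depending on a parameter *)

Lemma continuity_2d_slice_r (f : R -> R -> R) (x y : R) :
  continuity_2d_pt f x y -> continuity_pt (fun v => f x v) y.
Proof.
intros H e He; destruct (H (mkposreal e He)) as [d Hd].
exists d; split; [apply d | intros v [_ Hv]].
apply Hd; [ | exact Hv].
rewrite Rminus_diag, Rabs_R0; apply d.
Qed.

Lemma continuity_2d_slice_l (f : R -> R -> R) (x y : R) :
  continuity_2d_pt f x y -> continuity_pt (fun u => f u y) x.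
Proof.
intros H e He; destruct (H (mkposreal e He)) as [d Hd].
exists d; split; [apply d | intros v [_ Hv]].
apply Hd; [exact Hv | ].
rewrite Rminus_diag, Rabs_R0; apply d.
Qed.

Lemma continuity_pt_RInt_param (f : R -> R -> R) :
  (forall s z, continuity_2d_pt f s z) ->
  forall s, continuity_pt (fun r => RInt (f r) 0 1) s.
Proof.
intros Hf s e He.
assert (He2 : 0 < e / 2) by lra.
destruct (uniform_continuity_2d_1d' f 0 1 s (fun z _ => Hf s z)
            (mkposreal _ He2)) as [d Hd].
exists d; split; [apply d | ]; intros r [_ Hr].
simpl in Hr |- *; unfold Rdist in Hr |- *.
assert (Ex : forall q, ex_RInt (f q) 0 1).
{ intros q; apply ex_RInt_continuity; intros z.
  now apply continuity_2d_slice_r. }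
rewrite <- (RInt_minus (V := R_CompleteNormedModule)) by apply Ex.
apply Rle_lt_trans with ((1 - 0) * (e / 2)); [ | lra].
apply abs_RInt_le_const; [lra | now apply (ex_RInt_minus (V := R_NormedModule)) | ].
intros z Hz; left.
assert (P := cond_pos d); apply Rabs_def2 in Hr.
apply Hd; try easy; try lra.
rewrite Rminus_diag, Rabs_R0; easy.
Qed.

(** * Energies of classical solutions *)

(** Classical solutions of [u_t = a u_zz] on [(0, +oo) * (0, 1)], continuous
    up to [s = 0] and with [u_t] and [u_z] continuous up to [z = 0] and
    [z = 1]. Asking for continuity of [u] on the whole plane, which clamping
    the arguments to the strip provides, makes every integrand continuous at
    every [z]. *)
Definition caloric (a : R) (u ut : R -> R -> R) : Prop :=
  (forall s z, continuity_2d_pt u s z) /\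
  (forall s z, 0 < s ->
     is_derive (fun r => u r z) s (ut s z) /\ continuity_2d_pt ut s z) /\
  (forall s, 0 < s -> exists uz : R -> R,
     (forall z, continuity_pt uz z) /\
     forall z, 0 < z < 1 ->
       is_derive (u s) z (uz z) /\ is_derive uz z (ut s z / a)).

Lemma caloric_lin (a c : R) (u ut v vt : R -> R -> R) :
  caloric a u ut -> caloric a v vt ->
  caloric a (fun s z => c * u s z - v s z) (fun s z => c * ut s z - vt s z).
Proof.
intros [Cu [Tu Zu]] [Cv [Tv Zv]]; split; [ | split].
- intros s z; apply continuity_2d_pt_minus; [ | apply Cv].
  apply continuity_2d_pt_mult; [apply continuity_2d_pt_const | apply Cu].
- intros s z Hs; destruct (Tu s z Hs) as [Du Ku], (Tv s z Hs) as [Dv Kv].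
  split.
  + apply is_derive_sub; [ | exact Dv].
    now apply is_derive_scal.
  + apply continuity_2d_pt_minus; [ | exact Kv].
    apply continuity_2d_pt_mult; [apply continuity_2d_pt_const | exact Ku].
- intros s Hs; destruct (Zu s Hs) as [p [Cp Dp]], (Zv s Hs) as [q [Cq Dq]].
  exists (fun z => c * p z - q z); split.
  + intros z; apply continuity_pt_minus; [ | apply Cq].
    apply continuity_pt_mult; [ | apply Cp].
    apply continuity_pt_const; now intros x y.
  + intros z Hz; destruct (Dp z Hz) as [P1 P2], (Dq z Hz) as [Q1 Q2].
    split.
    * apply is_derive_sub; [ | exact Q1].
      now apply is_derive_scal.
    * replace ((c * ut s z - vt s z) / a)
        with (c * (ut s z / a) - vt s z / a) by (unfold Rdiv; ring).
      apply is_derive_sub; [ | exact Q2].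
      now apply is_derive_scal.
Qed.

Lemma caloric_slice (a : R) (u ut : R -> R -> R) (s z : R) :
  caloric a u ut -> continuity_pt (u s) z.
Proof. intros [Cu _]; apply (continuity_2d_slice_r u), Cu. Qed.

Lemma energy_continuity_2d (m eta : R -> R) (u : R -> R -> R) (s z : R) :
  (forall y, continuity_pt m y) -> (forall y, continuity_pt eta y) ->
  continuity_2d_pt u s z ->
  continuity_2d_pt (fun r y => m y * eta (u r y)) s z.
Proof.
intros Hm He Hu; apply continuity_2d_pt_mult.
- apply (continuity_1d_2d_pt_comp m (fun _ y => y)); [apply Hm | ].
  apply continuity_2d_pt_id2.
- now apply (continuity_1d_2d_pt_comp eta u).
Qed.

Lemma energy_derive (a : R) (u ut : R -> R -> R) (m eta eta1 : R -> R) :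
  caloric a u ut ->
  (forall y, continuity_pt m y) ->
  (forall y, is_derive eta y (eta1 y)) ->
  (forall y, continuity_pt eta1 y) ->
  forall s, 0 < s ->
  is_derive (fun r => RInt (fun z => m z * eta (u r z)) 0 1) s
    (RInt (fun z => m z * (eta1 (u s z) * ut s z)) 0 1).
Proof.
intros [Cu [Tu _]] Hm He He1 s Hs.
assert (Ce : forall y, continuity_pt eta y)
  by (intros y; now apply is_derive_continuity_pt with (eta1 y)).
assert (D : forall r z, 0 < r -> is_derive (fun q => m z * eta (u q z)) r
              (m z * (eta1 (u r z) * ut r z))).
{ intros r z Hr; apply is_derive_scal.
  rewrite Rmult_comm; apply (is_derive_comp eta (fun q => u q z));
    [apply He | now apply Tu]. }
assert (L : locally s (fun r => 0 < r)).
{ exists (mkposreal s Hs); intros r Hr.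
  change (Rabs (r - s) < s) in Hr; apply Rabs_def2 in Hr; lra. }
rewrite (RInt_ext _ (fun z => Derive (fun q => m z * eta (u q z)) s))
  by (intros z _; symmetry; now apply is_derive_unique, D).
apply (is_derive_RInt_param (fun r z => m z * eta (u r z))).
- apply filter_imp with (2 := L); intros r Hr z _.
  exists (m z * (eta1 (u r z) * ut r z)); now apply D.
- intros z _.
  apply continuity_2d_pt_ext_loc
    with (fun r y => m y * (eta1 (u r y) * ut r y)).
  + exists (mkposreal s Hs); intros r y Hr _; simpl in Hr.
    symmetry; apply is_derive_unique, D.
    apply Rabs_def2 in Hr; lra.
  + apply continuity_2d_pt_mult.
    * apply (continuity_1d_2d_pt_comp m (fun _ y => y)); [apply Hm | ].
      apply continuity_2d_pt_id2.
    * apply continuity_2d_pt_mult; [ | now apply Tu].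
      now apply (continuity_1d_2d_pt_comp eta1 u).
- apply filter_forall; intros r; apply ex_RInt_continuity; intros y.
  apply (continuity_2d_slice_r (fun r y => m y * eta (u r y))).
  now apply energy_continuity_2d.
Qed.

Lemma energy_decay (a : R) (u ut : R -> R -> R) (m eta eta1 : R -> R)
    (c b T : R) :
  caloric a u ut ->
  (forall y, continuity_pt m y) ->
  (forall y, is_derive eta y (eta1 y)) ->
  (forall y, continuity_pt eta1 y) ->
  c <> 0 -> 0 <= T ->
  (forall s, 0 < s < T ->
     RInt (fun z => m z * (eta1 (u s z) * ut s z)) 0 1
       <= b - c * RInt (fun z => m z * eta (u s z)) 0 1) ->
  RInt (fun z => m z * eta (u T z)) 0 1
    <= exp (- (c * T)) * RInt (fun z => m z * eta (u 0 z)) 0 1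
       + b / c * (1 - exp (- (c * T))).
Proof.
intros Hu Hm He He1 Hc HT H.
apply (gronwall (fun s => RInt (fun z => m z * eta (u s z)) 0 1)
         (fun s => RInt (fun z => m z * (eta1 (u s z) * ut s z)) 0 1));
  try easy.
- intros s _.
  apply (continuity_pt_RInt_param (fun s z => m z * eta (u s z))).
  intros r z; apply energy_continuity_2d; [easy | | apply Hu].
  intros y; now apply is_derive_continuity_pt with (eta1 y).
- intros s Hs; now apply (energy_derive a).
Qed.

(** The time derivative of an energy is [a] times the integral of
    [m eta'(u) u_zz]; it is bounded by comparing the integrand with the
    derivative of a function [G] of [z], which plays the part of an
    integration by parts. *)
Lemma energy_rate_le (a : R) (u ut : R -> R -> R) (m eta1 f G g : R -> R)
    (s : R) :
  0 < a -> 0 < s -> caloric a u ut ->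
  (forall y, continuity_pt m y) ->
  (forall y, continuity_pt eta1 y) ->
  (forall y, continuity_pt f y) ->
  (forall z, 0 <= z <= 1 -> continuity_pt G z) ->
  (forall z, 0 < z < 1 -> is_derive G z (g z)) ->
  (forall z, 0 < z < 1 ->
     m z * (eta1 (u s z) * (ut s z / a)) + f z <= g z) ->
  RInt (fun z => m z * (eta1 (u s z) * ut s z)) 0 1
    <= a * (G 1 - G 0) - a * RInt f 0 1.
Proof.
intros Ha Hs Hu Hm He Hf HG Hg Hle.
set (k := fun z => m z * (eta1 (u s z) * ut s z)).
assert (Ck : forall z, continuity_pt k z).
{ intros z; unfold k; apply continuity_pt_mult; [apply Hm | ].
  apply continuity_pt_mult.
  - apply (continuity_pt_comp (u s) eta1); [ | apply He].
    now apply (caloric_slice a u ut).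
  - apply (continuity_2d_slice_r ut); now apply Hu. }
assert (I : RInt (fun z => / a * k z + f z) 0 1 <= G 1 - G 0).
{ apply (RInt_le_increment G g); [lra | | easy | easy | ].
  - intros z; apply continuity_pt_plus; [ | apply Hf].
    apply continuity_pt_mult; [ | apply Ck].
    apply continuity_pt_const; now intros x y.
  - intros z Hz; specialize (Hle z Hz).
    unfold k, Rdiv in Hle |- *; lra. }
rewrite (RInt_add (fun z => / a * k z) f) in I.
- rewrite (RInt_mulc k) in I by now apply ex_RInt_continuity.
  apply Rmult_le_compat_l with (r := a) in I; [ | lra].
  replace (a * (/ a * RInt k 0 1 + RInt f 0 1))
    with (RInt k 0 1 + a * RInt f 0 1) in I by (field; lra).
  lra.
- apply (ex_RInt_scal (V := R_NormedModule) k).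
  now apply ex_RInt_continuity.
- now apply ex_RInt_continuity.
Qed.

(** * The sine-weighted integral of the absolute value *)

Lemma soft_abs_pos (e y : R) : 0 < e -> 0 < y ^ 2 + e ^ 2.
Proof. intros He; assert (0 < e ^ 2) by now apply pow_lt. nra. Qed.

Lemma soft_abs_bounds (e y : R) :
  0 < e -> Rabs y <= sqrt (y ^ 2 + e ^ 2) <= Rabs y + e.
Proof.
intros He; assert (P := Rabs_pos y).
assert (Q : Rabs y ^ 2 = y ^ 2) by apply pow2_abs.
rewrite <- Q; split.
- rewrite <- (sqrt_pow2 (Rabs y)) at 1 by easy.
  apply sqrt_le_1_alt; assert (0 <= e ^ 2) by apply pow2_ge_0; lra.
- rewrite <- (sqrt_pow2 (Rabs y + e)) by lra.
  apply sqrt_le_1_alt; nra.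
Qed.

Lemma soft_abs_derive (e y : R) :
  0 < e ->
  is_derive (fun x => sqrt (x ^ 2 + e ^ 2)) y (y / sqrt (y ^ 2 + e ^ 2)).
Proof.
intros He; assert (P := soft_abs_pos e y He).
auto_derive.
- simpl in P |- *; lra.
- assert (S := sqrt_lt_R0 _ P).
  replace (y * (y * 1) + e * (e * 1)) with (y ^ 2 + e ^ 2) by ring.
  field; lra.
Qed.

Lemma soft_abs_derive2 (e y : R) :
  0 < e ->
  is_derive (fun x => x / sqrt (x ^ 2 + e ^ 2)) y
    (e ^ 2 / sqrt (y ^ 2 + e ^ 2) ^ 3).
Proof.
intros He; assert (P := soft_abs_pos e y He).
assert (S := sqrt_lt_R0 _ P).
assert (S2 := pow2_sqrt _ (Rlt_le _ _ P)).
auto_derive.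
- replace (y * (y * 1) + e * (e * 1)) with (y ^ 2 + e ^ 2) by ring.
  repeat split; lra.
- replace (y * (y * 1) + e * (e * 1)) with (y ^ 2 + e ^ 2) by ring.
  set (r := sqrt (y ^ 2 + e ^ 2)) in *.
  replace (e ^ 2) with (r ^ 2 - y ^ 2) by lra.
  field; lra.
Qed.

Lemma sin_pi_nonneg (z : R) : 0 <= z <= 1 -> 0 <= sin (PI * z).
Proof.
intros Hz; assert (P := PI_RGT_0).
apply sin_ge_0; [apply Rmult_le_pos; lra | ].
rewrite <- (Rmult_1_r PI) at 2; apply Rmult_le_compat_l; lra.
Qed.

Lemma continuity_sin_pi (z : R) : continuity_pt (fun z => sin (PI * z)) z.
Proof.
apply (is_derive_continuity_pt _ _ (PI * cos (PI * z))).
auto_derive; [easy | ring].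
Qed.

(** The weight [sin (PI z)] is the first Dirichlet eigenfunction, so two
    integrations by parts give back [- PI ^ 2] times the energy and the
    boundary values of [eta u]; convexity of [eta] is what allows to drop the
    remaining term [sin (PI z) eta''(u) u_z ^ 2]. *)
Lemma soft_abs_decay (a : R) (u ut : R -> R -> R) (e M T : R) :
  0 < a -> 0 < e -> 0 <= T -> caloric a u ut ->
  (forall s, 0 < s < T ->
     sqrt (u s 0 ^ 2 + e ^ 2) + sqrt (u s 1 ^ 2 + e ^ 2) <= M) ->
  RInt (fun z => sin (PI * z) * sqrt (u T z ^ 2 + e ^ 2)) 0 1
    <= exp (- (a * PI ^ 2 * T))
         * RInt (fun z => sin (PI * z) * sqrt (u 0 z ^ 2 + e ^ 2)) 0 1
       + M / PI * (1 - exp (- (a * PI ^ 2 * T))).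
Proof.
intros Ha He HT Hu HM; assert (P := PI_RGT_0).
assert (P2 : 0 < a * PI ^ 2) by (apply Rmult_lt_0_compat, pow_lt; easy).
set (eta := fun y => sqrt (y ^ 2 + e ^ 2)).
set (eta1 := fun y => y / sqrt (y ^ 2 + e ^ 2)).
set (eta2 := fun y => e ^ 2 / sqrt (y ^ 2 + e ^ 2) ^ 3).
assert (D1 : forall y, is_derive eta y (eta1 y))
  by (intros y; now apply soft_abs_derive).
assert (D2 : forall y, is_derive eta1 y (eta2 y))
  by (intros y; now apply soft_abs_derive2).
assert (C0 : forall y, continuity_pt eta y)
  by (intros y; now apply is_derive_continuity_pt with (eta1 y)).
assert (C1 : forall y, continuity_pt eta1 y)
  by (intros y; now apply is_derive_continuity_pt with (eta2 y)).
assert (Pos : forall y, 0 <= eta2 y).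
{ intros y; assert (S := sqrt_lt_R0 _ (soft_abs_pos e y He)).
  apply Rdiv_le_0_compat; [apply pow2_ge_0 | now apply pow_lt]. }
replace (M / PI) with (a * PI * M / (a * PI ^ 2)) by (field; lra).
apply (energy_decay a u ut (fun z => sin (PI * z)) eta eta1); try easy.
- intros y; apply continuity_sin_pi.
- lra.
- intros s Hs.
  destruct Hu as [Cu [Tu Zu]].
  destruct (Zu s (proj1 Hs)) as [p [Cp Dp]].
  set (f := fun z => PI ^ 2 * (sin (PI * z) * eta (u s z))).
  set (G := fun z => sin (PI * z) * (eta1 (u s z) * p z)
                     - PI * cos (PI * z) * eta (u s z)).
  assert (Cs : forall z, continuity_pt (u s) z)
    by (intros z; apply (continuity_2d_slice_r u), Cu).
  assert (Cf0 : forall z, continuity_pt (fun z => sin (PI * z) * eta (u s z)) z).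
  { intros z; apply continuity_pt_mult; [apply continuity_sin_pi | ].
    now apply (continuity_pt_comp (u s) eta). }
  eapply Rle_trans.
  + apply (energy_rate_le a u ut (fun z => sin (PI * z)) eta1 f G
      (fun z => sin (PI * z) * (eta2 (u s z) * p z ^ 2)
                + (sin (PI * z) * (eta1 (u s z) * (ut s z / a)) + f z)) s);
      try easy.
    * intros z; apply continuity_sin_pi.
    * intros z; unfold f.
      apply continuity_pt_mult; [ | apply Cf0].
      apply continuity_pt_const; now intros x y.
    * intros z _; unfold G; apply continuity_pt_minus.
      -- apply continuity_pt_mult; [apply continuity_sin_pi | ].
         apply continuity_pt_mult; [ | apply Cp].
         now apply (continuity_pt_comp (u s) eta1).
      -- apply continuity_pt_mult.
         ++ apply (is_derive_continuity_pt _ _ (- PI * PI * sin (PI * z))).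
            auto_derive; [easy | ring].
         ++ now apply (continuity_pt_comp (u s) eta).
    * intros z Hz; destruct (Dp z Hz) as [Du Dq].
      assert (X0 : is_derive (fun z => eta (u s z)) z (p z * eta1 (u s z)))
        by now apply (is_derive_comp eta (u s)).
      assert (X1 : is_derive (fun z => eta1 (u s z)) z (p z * eta2 (u s z)))
        by now apply (is_derive_comp eta1 (u s)).
      assert (S1 : is_derive (fun z => sin (PI * z)) z (PI * cos (PI * z)))
        by (auto_derive; [easy | ring]).
      assert (S2 : is_derive (fun z => PI * cos (PI * z)) z
                     (- PI ^ 2 * sin (PI * z)))
        by (auto_derive; [easy | ring]).
      unfold G, f.
      eapply is_derive_eq.
      -- apply is_derive_sub.
         ++ apply is_derive_prod; [apply S1 | ].
            apply is_derive_prod; [apply X1 | apply Dq].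
         ++ apply is_derive_prod; [apply S2 | apply X0].
      -- simpl; ring.
    * intros z Hz.
      assert (0 <= sin (PI * z) * (eta2 (u s z) * p z ^ 2)); [ | lra].
      apply Rmult_le_pos; [apply sin_pi_nonneg; lra | ].
      apply Rmult_le_pos; [apply Pos | apply pow2_ge_0].
  + unfold G, f.
    rewrite (RInt_mulc (fun z => sin (PI * z) * eta (u s z)))
      by now apply ex_RInt_continuity.
    rewrite Rmult_1_r, Rmult_0_r, sin_PI, cos_PI, sin_0, cos_0.
    specialize (HM s Hs); change (eta (u s 0) + eta (u s 1) <= M) in HM.
    apply Rmult_le_compat_l with (r := a * PI) in HM;
      [ | apply Rmult_le_pos; lra].
    lra.
Qed.

Lemma sine_weighted_L1_decay (a : R) (u ut : R -> R -> R) (M0 M1 T : R) :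
  0 < a -> 0 <= T -> caloric a u ut ->
  (forall s, 0 <= s <= T -> Rabs (u s 0) <= M0) ->
  (forall s, 0 <= s <= T -> Rabs (u s 1) <= M1) ->
  RInt (fun z => sin (PI * z) * Rabs (u T z)) 0 1
    <= exp (- (a * PI ^ 2 * T))
         * RInt (fun z => sin (PI * z) * Rabs (u 0 z)) 0 1
       + 1 / PI * (M0 + M1).
Proof.
intros Ha HT Hu H0 H1; assert (P := PI_RGT_0); assert (P3 := PI2_3_2).
assert (M0P : 0 <= M0) by (eapply Rle_trans; [apply Rabs_pos | apply (H0 0); lra]).
assert (M1P : 0 <= M1) by (eapply Rle_trans; [apply Rabs_pos | apply (H1 0); lra]).
set (q := exp (- (a * PI ^ 2 * T))).
assert (Hq : 0 < q <= 1).
{ split; [apply exp_pos | ].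
  rewrite <- exp_0; apply exp_le_compat.
  assert (0 <= a * PI ^ 2 * T); [ | lra].
  apply Rmult_le_pos; [apply Rmult_le_pos | ]; try lra; apply pow2_ge_0. }
apply le_epsilon; intros d Hd.
set (e := d / 2); assert (He : 0 < e) by (unfold e; lra).
assert (D := soft_abs_decay a u ut e (M0 + M1 + 2 * e) T Ha He HT Hu).
fold q in D; lapply D; clear D.
2:{ intros s Hs.
    assert (B0 := soft_abs_bounds e (u s 0) He).
    assert (B1 := soft_abs_bounds e (u s 1) He).
    specialize (H0 s ltac:(lra)); specialize (H1 s ltac:(lra)); lra. }
intros D.
assert (Cu : forall s z, continuity_pt (u s) z)
  by (intros s z; now apply (caloric_slice a u ut)).
assert (I1 : forall s, ex_RInt (fun z => sin (PI * z) * Rabs (u s z)) 0 1).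
{ intros s; apply ex_RInt_continuity; intros z.
  apply continuity_pt_mult; [apply continuity_sin_pi | ].
  apply (continuity_pt_comp (u s) Rabs); [apply Cu | apply Rcontinuity_abs]. }
assert (I2 : forall s,
  ex_RInt (fun z => sin (PI * z) * sqrt (u s z ^ 2 + e ^ 2)) 0 1).
{ intros s; apply ex_RInt_continuity; intros z.
  apply continuity_pt_mult; [apply continuity_sin_pi | ].
  apply (continuity_pt_comp (u s) (fun y => sqrt (y ^ 2 + e ^ 2)));
    [apply Cu | ].
  eapply is_derive_continuity_pt, soft_abs_derive, He. }
assert (L : RInt (fun z => sin (PI * z) * Rabs (u T z)) 0 1
            <= RInt (fun z => sin (PI * z) * sqrt (u T z ^ 2 + e ^ 2)) 0 1).
{ apply RInt_le; [lra | apply I1 | apply I2 | intros z Hz].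
  apply Rmult_le_compat_l; [apply sin_pi_nonneg; lra | ].
  now apply soft_abs_bounds. }
assert (U : RInt (fun z => sin (PI * z) * sqrt (u 0 z ^ 2 + e ^ 2)) 0 1
            <= RInt (fun z => sin (PI * z) * Rabs (u 0 z)) 0 1 + e).
{ apply Rle_trans
    with (RInt (fun z => sin (PI * z) * Rabs (u 0 z) + e) 0 1).
  2:{ rewrite RInt_add, RInt_cst;
        [lra | apply I1 | apply (ex_RInt_const (V := R_NormedModule))]. }
  apply RInt_le; [lra | apply I2 | | ].
  - apply (ex_RInt_plus (V := R_NormedModule));
      [apply I1 | apply (ex_RInt_const (V := R_NormedModule))].
  - intros z Hz.
    assert (B := proj2 (soft_abs_bounds e (u 0 z) He)).
    assert (S0 := sin_pi_nonneg z ltac:(lra)).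
    assert (S1 := proj2 (SIN_bound (PI * z))).
    apply Rmult_le_compat_l with (r := sin (PI * z)) in B; nra. }
apply Rmult_le_compat_l with (r := q) in U; [ | lra].
assert (V : (M0 + M1 + 2 * e) / PI * (1 - q) <= 1 / PI * (M0 + M1) + e).
{ apply Rle_trans with ((M0 + M1 + 2 * e) / PI * 1).
  - apply Rmult_le_compat_l; [apply Rdiv_le_0_compat | ]; lra.
  - replace ((M0 + M1 + 2 * e) / PI * 1)
      with (1 / PI * (M0 + M1) + e * (2 / PI)) by (field; lra).
    apply Rplus_le_compat_l; rewrite <- (Rmult_1_r e) at 2.
    apply Rmult_le_compat_l; [lra | ].
    apply Rle_div_l; lra. }
assert (q * e <= e) by nra.
unfold e in *; lra.
Qed.

(** * Decay of the positive part *)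

Lemma RInt_vanishing_left (f : R -> R) (y : R) :
  (forall r, r <= 0 -> f r = 0) -> y <= 0 -> RInt f 0 y = 0.
Proof.
intros Hf Hy.
rewrite (RInt_ext f (fun _ => 0)).
- rewrite RInt_cst; apply Rmult_0_l.
- intros r; rewrite Rmin_right, Rmax_left by easy; intros Hr; apply Hf; lra.
Qed.

Definition half_line_profile (k : R -> R) : Prop :=
  (forall y, continuity_pt k y) /\
  (forall y, y <= 0 -> k y = 0) /\
  (forall x y, x <= y -> k x <= k y).

Definition slope_of (k : R -> R) (y : R) : R := RInt (fun r => k r ^ 2) 0 y.

(** The convex function with second derivative [k ^ 2] that vanishes on the
    negative half-line: a [C ^ 2] substitute for half the square of the
    positive part, which would correspond to the indicator function of the
    positive half-line. *)
Definition convex_of (k : R -> R) (y : R) : R := RInt (slope_of k) 0 y.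

Lemma continuity_sqr (f : R -> R) (z : R) :
  continuity_pt f z -> continuity_pt (fun y => f y ^ 2) z.
Proof.
intros H; apply (continuity_pt_mult f (fun y => f y * 1)); [easy | ].
apply continuity_pt_mult; [easy | ].
apply continuity_pt_const; now intros x y.
Qed.

Lemma slope_derive (k : R -> R) (y : R) :
  half_line_profile k -> is_derive (slope_of k) y (k y ^ 2).
Proof.
intros [Ck _]; apply (is_derive_primitive (fun r => k r ^ 2)); intros z.
now apply continuity_sqr.
Qed.

Lemma slope_continuity (k : R -> R) (y : R) :
  half_line_profile k -> continuity_pt (slope_of k) y.
Proof.
intros Hk; exact (is_derive_continuity_pt _ _ _ (slope_derive k y Hk)).
Qed.

Lemma slope_neg (k : R -> R) (y : R) :
  half_line_profile k -> y <= 0 -> slope_of k y = 0.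
Proof.
intros [_ [Zk _]]; apply RInt_vanishing_left; intros r Hr.
rewrite Zk by easy; ring.
Qed.

Lemma convex_derive (k : R -> R) (y : R) :
  half_line_profile k -> is_derive (convex_of k) y (slope_of k y).
Proof.
intros Hk; apply is_derive_primitive; intros z; now apply slope_continuity.
Qed.

Lemma convex_neg (k : R -> R) (y : R) :
  half_line_profile k -> y <= 0 -> convex_of k y = 0.
Proof.
intros Hk; apply RInt_vanishing_left; intros r Hr; now apply slope_neg.
Qed.

(** Both sides vanish at [0], and so do the derivatives; the comparison
    reduces to [k ^ 2 <= k y * k] on [0, y], that is, to the monotonicity of
    [k]. *)
Lemma convex_le_sqr_primitive (k : R -> R) (y : R) :
  half_line_profile k -> 2 * convex_of k y <= RInt k 0 y ^ 2.
Proof.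
intros Hk; assert (Hk' := Hk); destruct Hk' as [Ck [Zk Mk]].
destruct (Rle_lt_dec y 0) as [Hy | Hy].
{ rewrite convex_neg by easy.
  assert (0 <= RInt k 0 y ^ 2) by apply pow2_ge_0; lra. }
assert (Dp := is_derive_primitive k Ck 0).
assert (D : forall x, is_derive
    (fun y => RInt k 0 y * RInt k 0 y - 2 * convex_of k y) x
    (k x * RInt k 0 x + RInt k 0 x * k x - 2 * slope_of k x)).
{ intros x; apply is_derive_sub; [apply is_derive_prod; apply Dp | ].
  now apply is_derive_scal, convex_derive. }
assert (L : RInt k 0 0 * RInt k 0 0 - 2 * convex_of k 0
            <= RInt k 0 y * RInt k 0 y - 2 * convex_of k y).
{ apply (le_of_derive_ge0
           (fun y => RInt k 0 y * RInt k 0 y - 2 * convex_of k y) _ _ _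
           (Rlt_le _ _ Hy) (fun x _ => D x)).
  - intros x _; exact (is_derive_continuity_pt _ _ _ (D x)).
  - intros x Hx; unfold slope_of.
    assert (S : RInt (fun r => k r ^ 2) 0 x <= RInt (fun r => k x * k r) 0 x).
    { apply RInt_le; [lra | | | ].
      - apply ex_RInt_continuity; intros z; now apply continuity_sqr.
      - apply ex_RInt_continuity; intros z.
        apply continuity_pt_mult; [ | apply Ck].
        apply continuity_pt_const; now intros v w.
      - intros r Hr.
        assert (K0 := Mk 0 r ltac:(lra)); rewrite (Zk 0) in K0 by lra.
        assert (K1 := Mk r x ltac:(lra)); simpl; nra. }
    rewrite RInt_mulc in S by now apply ex_RInt_continuity.
    lra. }
rewrite RInt_point, convex_neg in L by (easy || lra).
unfold zero in L; simpl in L |- *; lra.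
Qed.

(** For [eta = convex_of k] and [psi] the primitive of [k], completing a
    square gives
    [eta''(u) u_z ^ 2 >= (psi(u) ^ 2 q)_z + phi ^ 2 psi(u) ^ 2]
    whenever [q' = - phi ^ 2 - q ^ 2], as does the logarithmic derivative [q]
    of [sin (theta + phi z)]; for [phi < PI] there is a [theta] making this
    sine positive on [0, 1], so that [q] is smooth there. This replaces the
    Poincare inequality in the energy estimate and yields the rate
    [2 a phi ^ 2]. *)
Lemma convex_energy_decay (a : R) (u ut : R -> R -> R) (k : R -> R)
    (phi T : R) :
  0 < a -> 0 < phi < PI -> 0 <= T -> half_line_profile k ->
  caloric a u ut ->
  (forall s, 0 < s < T -> u s 0 <= 0 /\ u s 1 <= 0) ->
  RInt (fun z => convex_of k (u T z)) 0 1
    <= exp (- (2 * a * phi ^ 2 * T))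
         * RInt (fun z => convex_of k (u 0 z)) 0 1.
Proof.
intros Ha Hphi HT Hk Hu Hb.
assert (Hk' := Hk); destruct Hk' as [Ck [Zk Mk]].
assert (P2 : 0 < 2 * a * phi ^ 2)
  by (repeat apply Rmult_lt_0_compat; simpl; nra).
set (eta := convex_of k); set (eta1 := slope_of k).
set (psi := (fun y => RInt k 0 y) : R -> R).
assert (De : forall y, is_derive eta y (eta1 y))
  by (intros y; now apply convex_derive).
assert (De1 : forall y, is_derive eta1 y (k y ^ 2))
  by (intros y; now apply slope_derive).
assert (Dpsi : forall y, is_derive psi y (k y))
  by (intros y; now apply is_derive_primitive).
assert (C0 : forall y, continuity_pt eta y)
  by (intros y; now apply is_derive_continuity_pt with (eta1 y)).
assert (C1 : forall y, continuity_pt eta1 y)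
  by (intros y; now apply is_derive_continuity_pt with (k y ^ 2)).
assert (C2 : forall y, continuity_pt psi y)
  by (intros y; now apply is_derive_continuity_pt with (k y)).
assert (One : forall s, RInt (fun z => eta (u s z)) 0 1
                        = RInt (fun z => 1 * eta (u s z)) 0 1)
  by (intros s; apply RInt_ext; intros z _; symmetry; apply Rmult_1_l).
rewrite !One.
replace (exp (- (2 * a * phi ^ 2 * T)) * RInt (fun z => 1 * eta (u 0 z)) 0 1)
  with (exp (- (2 * a * phi ^ 2 * T)) * RInt (fun z => 1 * eta (u 0 z)) 0 1
        + 0 / (2 * a * phi ^ 2) * (1 - exp (- (2 * a * phi ^ 2 * T))))
  by (unfold Rdiv; ring).
apply (energy_decay a u ut (fun _ => 1) eta eta1); try easy.
- intros y; apply continuity_pt_const; now intros v w.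
- lra.
- intros s Hs; rewrite <- One.
  assert (Cs : forall z, continuity_pt (u s) z)
    by (intros z; now apply (caloric_slice a u ut)).
  assert (Hu' := Hu); destruct Hu' as [Cu [Tu Zu]].
  destruct (Zu s (proj1 Hs)) as [p [Cp Dp]].
  set (theta := (PI - phi) / 2).
  assert (Sin : forall z, 0 <= z <= 1 -> 0 < sin (theta + phi * z)).
  { intros z Hz; apply sin_gt_0; unfold theta; nra. }
  set (q := fun z => phi * cos (theta + phi * z) / sin (theta + phi * z)).
  assert (Dq : forall z, 0 <= z <= 1 ->
            is_derive q z (- phi ^ 2 - q z ^ 2)).
  { intros z Hz; specialize (Sin z Hz); unfold q; auto_derive; [lra | ].
    field; lra. }
  set (f := fun z => phi ^ 2 * psi (u s z) ^ 2).
  assert (Cf0 : forall z, continuity_pt (fun z => psi (u s z) ^ 2) z).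
  { intros z; apply continuity_sqr.
    now apply (continuity_pt_comp (u s) psi). }
  assert (Cf : forall z, continuity_pt f z).
  { intros z; apply continuity_pt_mult; [ | apply Cf0].
    apply continuity_pt_const; now intros v w. }
  set (G := fun z => eta1 (u s z) * p z - psi (u s z) * psi (u s z) * q z).
  eapply Rle_trans.
  + apply (energy_rate_le a u ut (fun _ => 1) eta1 f G
      (fun z => p z * k (u s z) ^ 2 * p z + eta1 (u s z) * (ut s z / a)
         - ((p z * k (u s z) * psi (u s z) + psi (u s z) * (p z * k (u s z)))
              * q z
            + psi (u s z) * psi (u s z) * (- phi ^ 2 - q z ^ 2))) s); try easy.
    * intros y; apply continuity_pt_const; now intros v w.
    * intros z Hz; unfold G; apply continuity_pt_minus.
      -- apply continuity_pt_mult; [ | apply Cp].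
         now apply (continuity_pt_comp (u s) eta1).
      -- apply continuity_pt_mult;
           [ | exact (is_derive_continuity_pt _ _ _ (Dq z Hz))].
         apply continuity_pt_mult; now apply (continuity_pt_comp (u s) psi).
    * intros z Hz; destruct (Dp z Hz) as [Du Dp'].
      assert (X1 : is_derive (fun z => eta1 (u s z)) z (p z * k (u s z) ^ 2))
        by now apply (is_derive_comp eta1 (u s)).
      assert (X2 : is_derive (fun z => psi (u s z)) z (p z * k (u s z)))
        by now apply (is_derive_comp psi (u s)).
      unfold G; apply is_derive_sub.
      -- now apply (is_derive_prod (fun z => eta1 (u s z)) p).
      -- apply (is_derive_prod (fun z => psi (u s z) * psi (u s z)) q);
           [ | apply Dq; lra].
         now apply (is_derive_prod (fun z => psi (u s z))
                                   (fun z => psi (u s z))).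
    * intros z Hz; unfold f.
      assert (0 <= (k (u s z) * p z - psi (u s z) * q z) ^ 2)
        by apply pow2_ge_0.
      lra.
  + destruct (Hb s Hs) as [B0 B1].
    unfold G, eta1; rewrite !slope_neg by easy.
    assert (Z : forall y, y <= 0 -> psi y = 0)
      by (intros y; now apply RInt_vanishing_left).
    rewrite !Z by easy; unfold f.
    rewrite RInt_mulc by now apply ex_RInt_continuity.
    assert (L : 2 * RInt (fun z => eta (u s z)) 0 1
                <= RInt (fun z => psi (u s z) ^ 2) 0 1).
    { assert (I : ex_RInt (fun z => eta (u s z)) 0 1).
      { apply ex_RInt_continuity; intros z.
        now apply (continuity_pt_comp (u s) eta). }
      rewrite <- RInt_mulc by easy.
      apply RInt_le; [lra | | now apply ex_RInt_continuity | ].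
      - now apply (ex_RInt_scal (V := R_NormedModule)
                     (fun z => eta (u s z))).
      - intros z _; now apply convex_le_sqr_primitive. }
    apply Rmult_le_compat_l with (r := a * phi ^ 2) in L; [lra | ].
    apply Rmult_le_pos; [lra | apply pow2_ge_0].
Qed.

(** Approximates the indicator function of the positive half-line from below
    as [e] tends to [0]. *)
Definition ramp (e y : R) : R := Rmax 0 (Rmin 1 (y / e)).

Lemma ramp_profile (e : R) : 0 < e -> half_line_profile (ramp e).
Proof.
intros He; assert (Hi := Rinv_0_lt_compat e He); split; [ | split].
- intros y; unfold ramp; apply continuity_pt_Rmax, continuity_pt_Rmin.
  apply (is_derive_continuity_pt _ _ (/ e)); auto_derive; [easy | ring].
- intros y Hy; unfold ramp, Rdiv.
  assert (y * / e <= 0) by nra.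
  rewrite Rmin_right, Rmax_left; lra.
- intros x y Hxy; unfold ramp, Rdiv.
  assert (x * / e <= y * / e) by nra.
  apply Rle_max_compat_l, Rle_min_compat_l; easy.
Qed.

Lemma ramp_bounds (e y : R) : 0 <= ramp e y <= 1.
Proof.
unfold ramp; split; [apply Rmax_l | ].
apply Rmax_lub; [lra | apply Rmin_l].
Qed.

Lemma ramp_slope_bounds (e y : R) :
  0 < e -> 0 <= y -> y - e <= slope_of (ramp e) y <= y.
Proof.
intros He Hy; assert (Hk := ramp_profile e He).
assert (I : forall b c, ex_RInt (fun r => ramp e r ^ 2) b c).
{ intros b c; apply ex_RInt_continuity; intros z; now apply continuity_sqr, Hk. }
assert (B : forall r, 0 <= ramp e r ^ 2 <= 1)
  by (intros r; assert (H := ramp_bounds e r); simpl; nra).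
split.
- destruct (Rle_lt_dec y e) as [Hye | Hye].
  + apply Rle_trans with 0; [lra | ].
    apply RInt_ge_0; [easy | apply I | intros r _; apply B].
  + unfold slope_of; rewrite <- (RInt_Chasles _ 0 e y) by apply I.
    change (y - e <= RInt (fun r => ramp e r ^ 2) 0 e
                     + RInt (fun r => ramp e r ^ 2) e y).
    assert (0 <= RInt (fun r => ramp e r ^ 2) 0 e)
      by (apply RInt_ge_0; [lra | apply I | intros r _; apply B]).
    rewrite (RInt_ext (fun r => ramp e r ^ 2) (fun _ => 1) e y).
    * rewrite RInt_cst; lra.
    * intros r; rewrite Rmin_left, Rmax_right by lra; intros Hr.
      unfold ramp; rewrite Rmin_left, Rmax_right; [apply pow1 | lra | ].
      apply Rle_div_r; lra.
- apply Rle_trans with (RInt (fun _ => 1) 0 y); [ | rewrite RInt_cst; lra].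
  apply RInt_le; [easy | apply I | apply (ex_RInt_const (V := R_NormedModule)) | ].
  intros r _; apply B.
Qed.

Lemma ramp_convex_bounds (e y : R) :
  0 < e ->
  Rmax 0 y ^ 2 / 2 - e * Rmax 0 y <= convex_of (ramp e) y <= Rmax 0 y ^ 2 / 2.
Proof.
intros He; assert (Hk := ramp_profile e He).
destruct (Rle_lt_dec y 0) as [Hy | Hy].
{ rewrite convex_neg, Rmax_left by easy; lra. }
rewrite Rmax_right by lra.
assert (D0 := fun x => convex_derive (ramp e) x Hk).
assert (D1 : forall x, is_derive
  (fun y => convex_of (ramp e) y - (y ^ 2 / 2 - e * y)) x
  (slope_of (ramp e) x - (x - e))).
{ intros x; apply is_derive_sub; [apply D0 | ].
  auto_derive; [easy | field]. }
assert (D2 : forall x, is_derive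
  (fun y => y ^ 2 / 2 - convex_of (ramp e) y) x
  (x - slope_of (ramp e) x)).
{ intros x; apply is_derive_sub; [ | apply D0].
  auto_derive; [easy | field]. }
assert (L1 := le_of_derive_ge0 _ _ 0 y (Rlt_le _ _ Hy) (fun x _ => D1 x)
  (fun x _ => is_derive_continuity_pt _ _ _ (D1 x))).
assert (L2 := le_of_derive_ge0 _ _ 0 y (Rlt_le _ _ Hy) (fun x _ => D2 x)
  (fun x _ => is_derive_continuity_pt _ _ _ (D2 x))).
cbv beta in L1, L2; rewrite convex_neg in L1, L2 by (easy || lra).
split.
- lapply L1; [lra | intros x Hx].
  assert (B := ramp_slope_bounds e x He ltac:(lra)); lra.
- lapply L2; [lra | intros x Hx].
  assert (B := ramp_slope_bounds e x He ltac:(lra)); lra.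
Qed.

Lemma le_of_left_limit (f : R -> R) (A c : R) :
  0 < c -> continuity_pt f c -> (forall x, 0 < x < c -> A <= f x) -> A <= f c.
Proof.
intros Hc Hf H; apply Rnot_lt_le; intros L.
destruct (Hf (A - f c)) as [d [Hd K]]; [lra | ].
set (x := Rmax (c / 2) (c - d / 2)).
assert (X : c / 2 <= x /\ c - d / 2 <= x /\ x < c).
{ unfold x; split; [apply Rmax_l | split; [apply Rmax_r | ]].
  apply Rmax_lub_lt; lra. }
assert (B : Rdist (f x) (f c) < A - f c).
{ apply K; split.
  - split; [exact I | lra].
  - simpl; unfold Rdist; apply Rabs_def1; lra. }
unfold Rdist in B; apply Rabs_def2 in B.
specialize (H x ltac:(lra)); lra.
Qed.

(** The convex functions attached to the ramps differ from half the square of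
    the positive part by at most [e] times the positive part, and the decay
    rate is [2 a phi ^ 2] for every [phi < PI]; the estimate is the limit
    [e -> 0], then [phi -> PI]. *)
Lemma pos_part_L2_decay (a : R) (u ut : R -> R -> R) (T : R) :
  0 < a -> 0 <= T -> caloric a u ut ->
  (forall s, 0 < s < T -> u s 0 <= 0 /\ u s 1 <= 0) ->
  RInt (fun z => Rmax 0 (u T z) ^ 2) 0 1
    <= exp (- (2 * a * PI ^ 2 * T)) * RInt (fun z => Rmax 0 (u 0 z) ^ 2) 0 1.
Proof.
intros Ha HT Hu Hb; assert (P := PI_RGT_0).
set (B := RInt (fun z => Rmax 0 (u 0 z) ^ 2) 0 1).
apply (le_of_left_limit (fun phi => exp (- (2 * a * phi ^ 2 * T)) * B));
  [easy | | ].
{ eapply is_derive_continuity_pt; auto_derive; [easy | reflexivity]. }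
intros phi Hphi.
assert (Cp : forall s z, continuity_pt (fun z => Rmax 0 (u s z)) z)
  by (intros s z; now apply continuity_pt_Rmax, (caloric_slice a u ut)).
assert (Ip : forall s, ex_RInt (fun z => Rmax 0 (u s z)) 0 1)
  by (intros s; now apply ex_RInt_continuity).
assert (Ip2 : forall s, ex_RInt (fun z => Rmax 0 (u s z) ^ 2) 0 1)
  by (intros s; apply ex_RInt_continuity; intros z; now apply continuity_sqr).
assert (Ip3 : forall s, ex_RInt (fun z => / 2 * Rmax 0 (u s z) ^ 2) 0 1)
  by (intros s; now apply (ex_RInt_scal (V := R_NormedModule)
                             (fun z => Rmax 0 (u s z) ^ 2))).
set (L := RInt (fun z => Rmax 0 (u T z)) 0 1).
assert (HL : 0 <= L)
  by (apply RInt_ge_0; [lra | apply Ip | intros z _; apply Rmax_l]).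
apply le_epsilon; intros d Hd.
set (e := d / (2 * (L + 1))).
assert (He : 0 < e) by (apply Rdiv_lt_0_compat; lra).
assert (Hk := ramp_profile e He).
assert (D := convex_energy_decay a u ut (ramp e) phi T Ha Hphi HT Hk Hu Hb).
assert (Ie : forall s, ex_RInt (fun z => convex_of (ramp e) (u s z)) 0 1).
{ intros s; apply ex_RInt_continuity; intros z.
  apply (continuity_pt_comp (u s) (convex_of (ramp e))).
  - now apply (caloric_slice a u ut).
  - exact (is_derive_continuity_pt _ _ _ (convex_derive _ _ Hk)). }
assert (L0 : RInt (fun z => convex_of (ramp e) (u 0 z)) 0 1 <= / 2 * B).
{ unfold B; rewrite <- RInt_mulc by easy.
  apply RInt_le; [lra | apply Ie | apply Ip3 | intros z _].
  assert (K := ramp_convex_bounds e (u 0 z) He); lra. }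
assert (L1 : / 2 * RInt (fun z => Rmax 0 (u T z) ^ 2) 0 1 + (- e) * L
             <= RInt (fun z => convex_of (ramp e) (u T z)) 0 1).
{ assert (Ip4 : ex_RInt (fun z => (- e) * Rmax 0 (u T z)) 0 1)
    by now apply (ex_RInt_scal (V := R_NormedModule)
                    (fun z => Rmax 0 (u T z))).
  unfold L; rewrite <- !RInt_mulc, <- RInt_add by easy.
  apply RInt_le; [lra | | apply Ie | intros z _].
  - now apply (ex_RInt_plus (V := R_NormedModule)).
  - assert (K := ramp_convex_bounds e (u T z) He); lra. }
set (w := exp (- (2 * a * phi ^ 2 * T))) in *.
assert (Hw : 0 < w) by apply exp_pos.
apply Rmult_le_compat_l with (r := w) in L0; [ | lra].
assert (E : 2 * e * L <= d).
{ replace d with (2 * e * (L + 1)) by (unfold e; field; lra).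
  apply Rmult_le_compat_l; lra. }
lra.
Qed.

Lemma RInt_nonneg_le0 (f : R -> R) (z : R) :
  (forall y, continuity_pt f y) -> (forall y, 0 <= f y) ->
  RInt f 0 1 <= 0 -> 0 < z < 1 -> f z = 0.
Proof.
intros Cf Pf H Hz.
assert (I : forall b c, ex_RInt f b c) by (intros; now apply ex_RInt_continuity).
assert (F0 : forall y, 0 < y < 1 -> RInt f 0 y = 0).
{ intros y Hy.
  assert (C := RInt_Chasles f 0 y 1 (I _ _) (I _ _)).
  change (RInt f 0 y + RInt f y 1 = RInt f 0 1) in C.
  assert (0 <= RInt f 0 y) by (apply RInt_ge_0; [lra | apply I | easy]).
  assert (0 <= RInt f y 1) by (apply RInt_ge_0; [lra | apply I | easy]).
  lra. }
assert (D := is_derive_primitive f Cf 0 z).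
rewrite <- (is_derive_unique _ _ _ D).
apply is_derive_unique.
apply (is_derive_ext_loc (fun _ => 0)).
- apply (locally_interval _ z 0 1); simpl; try easy.
  intros y H0 H1; symmetry; apply F0; easy.
- apply (is_derive_const (V := R_NormedModule)).
Qed.

(** The maximum principle, as the degenerate case of the decay of the
    positive part. *)
Lemma caloric_nonpos (a : R) (u ut : R -> R -> R) (T z : R) :
  0 < a -> 0 <= T -> caloric a u ut ->
  (forall s, 0 <= s <= T -> u s 0 <= 0 /\ u s 1 <= 0) ->
  (forall y, 0 <= y <= 1 -> u 0 y <= 0) ->
  0 <= z <= 1 -> u T z <= 0.
Proof.
intros Ha HT Hu Hb Hi Hz.
assert (D := pos_part_L2_decay a u ut T Ha HT Hu (fun s Hs => Hb s ltac:(lra))).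
rewrite (RInt_ext (fun z => Rmax 0 (u 0 z) ^ 2) (fun _ => 0)), RInt_cst in D.
2:{ rewrite Rmin_left, Rmax_right by lra; intros y Hy.
    rewrite Rmax_left by (apply Hi; lra); apply pow_i; auto with arith. }
destruct (Hb T ltac:(lra)) as [B0 B1].
destruct (Req_dec z 0) as [-> | N0]; [easy | ].
destruct (Req_dec z 1) as [-> | N1]; [easy | ].
assert (Z : Rmax 0 (u T z) ^ 2 = 0).
{ apply (RInt_nonneg_le0 (fun z => Rmax 0 (u T z) ^ 2)); [ | | lra | lra].
  - intros y; apply continuity_sqr, continuity_pt_Rmax.
    now apply (caloric_slice a u ut).
  - intros y; apply pow2_ge_0. }
apply Rnot_lt_le; intros L; rewrite Rmax_right in Z by lra.
assert (0 < u T z ^ 2) by now apply pow_lt.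
lra.
Qed.

(** * From relative to global regularity *)

Definition clamp (z : R) : R := Rmax 0 (Rmin 1 z).

Lemma clamp_unit (z : R) : unit_itv (clamp z).
Proof.
split; [apply Rmax_l | apply Rmax_lub; [lra | apply Rmin_l]].
Qed.

Lemma clamp_id (z : R) : unit_itv z -> clamp z = z.
Proof. intros [H0 H1]; unfold clamp; rewrite Rmin_right, Rmax_right; lra. Qed.

Lemma clamp_lipschitz (y z : R) : Rabs (clamp y - clamp z) <= Rabs (y - z).
Proof.
unfold clamp, Rmax, Rmin, Rabs;
  repeat destruct (Rle_dec _ _); repeat destruct (Rcase_abs _); lra.
Qed.

Lemma Rmax0_lipschitz (y z : R) : Rabs (Rmax 0 y - Rmax 0 z) <= Rabs (y - z).
Proof.
unfold Rmax, Rabs;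
  repeat destruct (Rle_dec _ _); repeat destruct (Rcase_abs _); lra.
Qed.

Lemma C0_on_retract (D : R * R -> Prop) (x : R -> R -> R) (f g : R -> R)
    (s z : R) :
  C0_on D x ->
  (forall r, Rabs (f r - f s) <= Rabs (r - s)) ->
  (forall y, Rabs (g y - g z) <= Rabs (y - z)) ->
  locally_2d (fun r y => D (f r, g y)) s z ->
  continuity_2d_pt (fun r y => x (f r) (g y)) s z.
Proof.
intros Cx Lf Lg HD e.
assert (Hsz := locally_2d_singleton _ _ _ HD).
destruct (Cx _ Hsz (fun v => Rabs (v - x (f s) (g z)) < e)) as [d1 H1].
{ now exists e. }
destruct HD as [d2 H2].
assert (Hd : 0 < Rmin d1 d2) by (apply Rmin_pos; apply cond_pos).
exists (mkposreal _ Hd); simpl; intros r y Hr Hy.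
assert (M1 := Rmin_l d1 d2); assert (M2 := Rmin_r d1 d2).
apply (H1 (f r, g y)).
- split; simpl.
  + apply Rle_lt_trans with (1 := Lf r); lra.
  + apply Rle_lt_trans with (1 := Lg y); lra.
- apply H2; lra.
Qed.

Lemma D_in_is_derive (f f1 : R -> R) (z : R) :
  0 < z < 1 -> D_in f f1 unit_itv z -> is_derive f z (f1 z).
Proof.
intros Hz H; apply is_derive_Reals; intros e He.
destruct (H e He) as [d [Hd K]].
assert (Hm : 0 < Rmin d (Rmin z (1 - z))).
{ repeat apply Rmin_pos; lra. }
exists (mkposreal _ Hm); simpl; intros h Hh Hhd.
assert (N1 := Rmin_l d (Rmin z (1 - z))).
assert (N2 := Rmin_r d (Rmin z (1 - z))).
assert (N3 := Rmin_l z (1 - z)); assert (N4 := Rmin_r z (1 - z)).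
specialize (K (z + h)); simpl in K; unfold Rdist in K.
replace (z + h - z) with h in K by ring.
apply K; split; [ | lra].
assert (B := Rabs_def2 h (Rmin d (Rmin z (1 - z))) Hhd).
repeat split; lra.
Qed.

Lemma D_in_clamp_continuity (f f1 : R -> R) :
  (forall z, unit_itv z -> D_in f f1 unit_itv z) ->
  forall z, continuity_pt (fun y => f (clamp y)) z.
Proof.
intros H z e He.
destruct (cont_deriv f f1 unit_itv (clamp z) (H _ (clamp_unit z)) e He)
  as [d [Hd K]].
exists d; split; [easy | intros y [_ Hy]].
simpl in *; unfold Rdist in *.
destruct (Req_dec (clamp z) (clamp y)) as [-> | N].
- now rewrite Rminus_diag, Rabs_R0.
- apply K; split.
  + split; [apply clamp_unit | easy].
  + apply Rle_lt_trans with (2 := Hy), clamp_lipschitz.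
Qed.

Lemma unit_interior (z : R) : 0 < z < 1 -> unit_itv z.
Proof. intros H; split; lra. Qed.

Lemma locally_interior (P : R -> Prop) (z : R) :
  0 < z < 1 -> (forall y, 0 < y < 1 -> P y) -> locally z P.
Proof.
intros Hz H; apply (locally_interval _ z 0 1); simpl; try easy.
intros y H0 H1; now apply H.
Qed.

(** Inside the interval the relative derivatives are derivatives, so the
    equation identifies [u_zz] with [u_t / a]; this makes [u_zz] jointly
    continuous up to the boundary, although it is assumed to be continuous
    only in [z], for each fixed time. *)
Lemma heat_solution_caloric (a : R) (x0 d0 d1 : R -> R) (x : R -> R -> R) :
  0 < a -> heat_solution a x0 d0 d1 x ->
  exists ut, caloric a (fun s z => x (Rmax 0 s) (clamp z)) ut.
Proof.
intros Ha [C0 [[xt [xz [Dt [_ [Ct _]]]]] [C2 [Heat _]]]].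
exists (fun s z => xt s (clamp z)); split; [ | split].
- intros s z; apply C0_on_retract with (1 := C0).
  + intros r; apply Rmax0_lipschitz.
  + intros y; apply clamp_lipschitz.
  + exists (mkposreal 1 Rlt_0_1); intros r y _ _.
    split; [apply Rmax_l | apply clamp_unit].
- intros s z Hs; split.
  + apply is_derive_ext_loc with (fun r => x r (clamp z)).
    * exists (mkposreal s Hs); intros r Hr.
      change (Rabs (r - s) < s) in Hr; apply Rabs_def2 in Hr.
      rewrite Rmax_right; [easy | lra].
    * apply Dt; [easy | apply clamp_unit].
  + apply (C0_on_retract _ xt (fun r => r) clamp) with (1 := Ct).
    * intros r; apply Rle_refl.
    * intros y; apply clamp_lipschitz.
    * exists (mkposreal s Hs); simpl; intros r y Hr _.
      apply Rabs_def2 in Hr; split; [simpl; lra | apply clamp_unit].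
- intros s Hs.
  destruct (C2 s (Rlt_le _ _ Hs)) as [f1 [f2 [D1 [D2 _]]]].
  exists (fun z => f1 (clamp z)); split.
  + apply D_in_clamp_continuity with (1 := D2).
  + intros z Hz; rewrite Rmax_right by lra.
    rewrite !clamp_id by now apply unit_interior.
    assert (I1 : forall y, 0 < y < 1 -> is_derive (x s) y (f1 y))
      by (intros y Hy; apply D_in_is_derive, D1, unit_interior; easy).
    assert (I2 : is_derive f1 z (f2 z))
      by (apply D_in_is_derive, D2, unit_interior; easy).
    split.
    * apply is_derive_ext_loc with (x s); [ | now apply I1].
      apply locally_interior; [easy | intros y Hy].
      now rewrite clamp_id by now apply unit_interior.
    * assert (E : xt s z = a * f2 z).
      { transitivity (Derive (fun r => x r z) s).
        - symmetry; apply is_derive_unique, Dt; [easy | now apply unit_interior].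
        - rewrite (Heat s z Hs Hz); f_equal.
          simpl; transitivity (Derive f1 z); [ | now apply is_derive_unique].
          apply Derive_ext_loc, locally_interior; [easy | intros y Hy].
          now apply is_derive_unique, I1. }
      rewrite E; replace (a * f2 z / a) with (f2 z) by (field; lra).
      apply is_derive_ext_loc with f1; [ | easy].
      apply locally_interior; [easy | intros y Hy].
      now rewrite clamp_id by now apply unit_interior.
Qed.

Lemma continuous_on_of_continuity (D : R -> Prop) (f g : R -> R) :
  (forall z, D z -> continuity_pt g z) -> (forall z, D z -> f z = g z) ->
  continuous_on D f.
Proof.
intros Cg E; apply continuous_on_ext with g; [intros z Hz; symmetry; now apply E | ].
intros z Hz P HP.
specialize (Cg z Hz); apply continuity_pt_filterlim in Cg.
specialize (Cg P HP); unfold filtermap, within in *.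
apply filter_imp with (2 := Cg); easy.
Qed.

Lemma le_max_itv (a b s : R) (f g : R -> R) :
  (forall z, a <= z <= b -> continuity_pt g z) ->
  (forall z, a <= z <= b -> f z = g z) ->
  a <= s <= b -> f s <= max_itv a b f.
Proof.
intros Cg E Hs.
destruct (max_itv_attained a b f) as [m [_ [_ H]]]; [lra | | now apply H].
now apply continuous_on_of_continuity with g.
Qed.

Lemma max_itv_le (a b c : R) (f : R -> R) :
  a <= b -> (forall s, a <= s <= b -> f s <= c) -> max_itv a b f <= c.
Proof.
intros Hab H; unfold max_itv.
destruct (Lub_Rbar_correct (fun y => exists s, a <= s <= b /\ y = f s))
  as [U L].
assert (L' := L c); lapply L'; clear L L'.
2:{ intros y [s [Hs ->]]; now apply H. }
assert (U' := U (f a) (ex_intro _ a (conj (conj (Rle_refl a) Hab) eq_refl))).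
now destruct (Lub_Rbar _).
Qed.

(** * The mean square estimate *)

Lemma L2_triangle (f g : R -> R) :
  (forall z, continuity_pt f z) -> (forall z, continuity_pt g z) ->
  sqrt (RInt (fun z => (f z + g z) ^ 2) 0 1)
    <= sqrt (RInt (fun z => f z ^ 2) 0 1) + sqrt (RInt (fun z => g z ^ 2) 0 1).
Proof.
intros Cf Cg.
assert (If : ex_RInt (fun z => f z ^ 2) 0 1)
  by (apply ex_RInt_continuity; intros z; now apply continuity_sqr).
assert (Ig : ex_RInt (fun z => g z ^ 2) 0 1)
  by (apply ex_RInt_continuity; intros z; now apply continuity_sqr).
assert (Is : ex_RInt (fun z => (f z + g z) ^ 2) 0 1).
{ apply ex_RInt_continuity; intros z; apply continuity_sqr.
  now apply continuity_pt_plus. }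
assert (Pf : 0 <= RInt (fun z => f z ^ 2) 0 1)
  by (apply RInt_ge_0; [lra | easy | intros z _; apply pow2_ge_0]).
assert (Pg : 0 <= RInt (fun z => g z ^ 2) 0 1)
  by (apply RInt_ge_0; [lra | easy | intros z _; apply pow2_ge_0]).
apply le_epsilon; intros d Hd.
(* Bounds that are strictly larger than the norms allow to divide by them. *)
set (A := sqrt (RInt (fun z => f z ^ 2) 0 1) + d / 2).
set (B := sqrt (RInt (fun z => g z ^ 2) 0 1) + d / 2).
assert (HA : 0 < A)
  by (assert (S := sqrt_pos (RInt (fun z => f z ^ 2) 0 1)); unfold A; lra).
assert (HB : 0 < B)
  by (assert (S := sqrt_pos (RInt (fun z => g z ^ 2) 0 1)); unfold B; lra).
assert (FA : RInt (fun z => f z ^ 2) 0 1 <= A ^ 2).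
{ rewrite <- (pow2_sqrt (RInt _ 0 1)) by easy.
  apply pow_incr; split; [apply sqrt_pos | unfold A; lra]. }
assert (GB : RInt (fun z => g z ^ 2) 0 1 <= B ^ 2).
{ rewrite <- (pow2_sqrt (RInt _ 0 1)) by easy.
  apply pow_incr; split; [apply sqrt_pos | unfold B; lra]. }
replace (sqrt (RInt (fun z => f z ^ 2) 0 1)
         + sqrt (RInt (fun z => g z ^ 2) 0 1) + d)
  with (A + B) by (unfold A, B; field).
rewrite <- (sqrt_pow2 (A + B)) by lra.
apply sqrt_le_1_alt.
assert (PA : 0 < B / A) by now apply Rdiv_lt_0_compat.
assert (PB : 0 < A / B) by now apply Rdiv_lt_0_compat.
apply Rle_trans
  with (RInt (fun z => (1 + B / A) * f z ^ 2 + (1 + A / B) * g z ^ 2) 0 1).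
- apply RInt_le; [lra | easy | | ].
  + apply (ex_RInt_plus (V := R_NormedModule)
             (fun z => (1 + B / A) * f z ^ 2)).
    * now apply (ex_RInt_scal (V := R_NormedModule) (fun z => f z ^ 2)).
    * now apply (ex_RInt_scal (V := R_NormedModule) (fun z => g z ^ 2)).
  + intros z _.
    assert (S : 0 <= (B * f z - A * g z) ^ 2 / (A * B)).
    { apply Rdiv_le_0_compat; [apply pow2_ge_0 | ].
      now apply Rmult_lt_0_compat. }
    replace ((1 + B / A) * f z ^ 2 + (1 + A / B) * g z ^ 2)
      with ((f z + g z) ^ 2 + (B * f z - A * g z) ^ 2 / (A * B))
      by (field; lra).
    lra.
- rewrite RInt_add, !RInt_mulc; try easy.
  2, 3: now apply (ex_RInt_scal (V := R_NormedModule) (fun z => _ z ^ 2)).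
  replace ((A + B) ^ 2) with ((1 + B / A) * A ^ 2 + (1 + A / B) * B ^ 2)
    by (field; lra).
  apply Rplus_le_compat; apply Rmult_le_compat_l; lra.
Qed.

Lemma affine_caloric (a M0 M1 : R) :
  a <> 0 ->
  caloric a (fun _ z => M0 * (1 - z) + M1 * z) (fun _ _ => 0).
Proof.
intros Ha.
assert (D : forall z, is_derive (fun z => M0 * (1 - z) + M1 * z) z (M1 - M0))
  by (intros z; auto_derive; [easy | ring]).
split; [ | split].
- intros s z.
  apply (continuity_1d_2d_pt_comp (fun z => M0 * (1 - z) + M1 * z)
           (fun _ y => y)); [ | apply continuity_2d_pt_id2].
  exact (is_derive_continuity_pt _ _ _ (D z)).
- intros s z _; split; [ | apply continuity_2d_pt_const].
  apply (is_derive_const (V := R_NormedModule)).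
- intros s _; exists (fun _ => M1 - M0); split.
  + intros z; apply continuity_pt_const; now intros x y.
  + intros z _; split; [apply D | ].
    replace (0 / a) with 0 by (field; easy).
    apply (is_derive_const (V := R_NormedModule)).
Qed.

Lemma affine_L2 (M0 M1 : R) :
  0 <= M0 -> 0 <= M1 ->
  sqrt (RInt (fun z => (M0 * (1 - z) + M1 * z) ^ 2) 0 1)
    <= 1 / sqrt 3 * (M0 + M1).
Proof.
intros H0 H1.
assert (S3 : 0 < sqrt 3) by (apply sqrt_lt_R0; lra).
assert (S32 : sqrt 3 ^ 2 = 3) by (apply pow2_sqrt; lra).
assert (Pos : 0 <= 1 / sqrt 3 * (M0 + M1)).
{ apply Rmult_le_pos; [apply Rdiv_le_0_compat | ]; lra. }
rewrite <- (sqrt_pow2 (1 / sqrt 3 * (M0 + M1))) by easy.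
apply sqrt_le_1_alt.
replace ((1 / sqrt 3 * (M0 + M1)) ^ 2) with ((M0 + M1) ^ 2 / sqrt 3 ^ 2)
  by (field; lra).
rewrite S32.
set (G := fun z => M0 ^ 2 * (z - z ^ 2 + z ^ 3 / 3)
  + 2 * M0 * M1 * (z ^ 2 / 2 - z ^ 3 / 3) + M1 ^ 2 * (z ^ 3 / 3)).
assert (D : forall z, is_derive G z ((M0 * (1 - z) + M1 * z) ^ 2))
  by (intros z; unfold G; auto_derive; [easy | simpl; field]).
apply Rle_trans with (G 1 - G 0).
- apply (RInt_le_increment G (fun z => (M0 * (1 - z) + M1 * z) ^ 2));
    [lra | | | easy | intros; apply Rle_refl].
  + intros z; eapply is_derive_continuity_pt; auto_derive; easy.
  + intros z _; exact (is_derive_continuity_pt _ _ _ (D z)).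
- unfold G; nra.
Qed.

(** With [l] the stationary solution taking the boundary values [M0] and
    [M1], the functions [u - l] and [- u - l] are nonpositive on the
    boundary, and the sum of their positive parts is [(|u| - l)^+]. *)
Lemma caloric_L2_bound (a : R) (u ut : R -> R -> R) (M0 M1 T : R) :
  0 < a -> 0 <= T -> caloric a u ut ->
  (forall s, 0 <= s <= T -> Rabs (u s 0) <= M0) ->
  (forall s, 0 <= s <= T -> Rabs (u s 1) <= M1) ->
  sqrt (RInt (fun z => u T z ^ 2) 0 1)
    <= exp (- (a * PI ^ 2 * T)) * sqrt (RInt (fun z => u 0 z ^ 2) 0 1)
       + 1 / sqrt 3 * (M0 + M1).
Proof.
intros Ha HT Hu H0 H1.
assert (P0 : 0 <= M0) by (eapply Rle_trans; [apply Rabs_pos | apply (H0 0); lra]).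
assert (P1 : 0 <= M1) by (eapply Rle_trans; [apply Rabs_pos | apply (H1 0); lra]).
set (l := fun z => M0 * (1 - z) + M1 * z).
assert (Pl : forall z, 0 <= z <= 1 -> 0 <= l z)
  by (intros z Hz; unfold l; nra).
assert (Hl := affine_caloric a M0 M1 (Rgt_not_eq _ _ Ha)).
set (up := fun s z => 1 * u s z - l z).
set (um := fun s z => -1 * u s z - l z).
assert (Hp := caloric_lin a 1 _ _ _ _ Hu Hl).
assert (Hm := caloric_lin a (-1) _ _ _ _ Hu Hl).
change (caloric a up (fun s z => 1 * ut s z - 0)) in Hp.
change (caloric a um (fun s z => -1 * ut s z - 0)) in Hm.
assert (Bd : forall s, 0 <= s <= T ->
  (up s 0 <= 0 /\ up s 1 <= 0) /\ (um s 0 <= 0 /\ um s 1 <= 0)).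
{ intros s Hs; specialize (H0 s Hs); specialize (H1 s Hs).
  apply Rabs_le_between in H0; apply Rabs_le_between in H1.
  unfold up, um, l; repeat split; lra. }
assert (Dp := pos_part_L2_decay a up _ T Ha HT Hp
  (fun s Hs => proj1 (Bd s ltac:(lra)))).
assert (Dm := pos_part_L2_decay a um _ T Ha HT Hm
  (fun s Hs => proj2 (Bd s ltac:(lra)))).
set (w := fun s z => Rmax 0 (up s z) + Rmax 0 (um s z)).
assert (Cp : forall s z, continuity_pt (fun z => Rmax 0 (up s z)) z)
  by (intros s z; now apply continuity_pt_Rmax, (caloric_slice a up _ s z Hp)).
assert (Cm : forall s z, continuity_pt (fun z => Rmax 0 (um s z)) z)
  by (intros s z; now apply continuity_pt_Rmax, (caloric_slice a um _ s z Hm)).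
assert (Cw : forall s z, continuity_pt (w s) z)
  by (intros s z; now apply continuity_pt_plus).
assert (Cu : forall s z, continuity_pt (u s) z)
  by (intros s z; now apply (caloric_slice a u ut)).
assert (Cl : forall z, continuity_pt l z)
  by (intros z; now apply (caloric_slice a (fun _ => l) (fun _ _ => 0) 0)).
assert (I2 : forall f : R -> R, (forall z, continuity_pt f z) ->
               ex_RInt (fun z => f z ^ 2) 0 1).
{ intros f Cf; apply ex_RInt_continuity; intros z; now apply continuity_sqr. }
(* Since [0 <= l], at most one of the two positive parts is nonzero. *)
assert (W : forall s, RInt (fun z => w s z ^ 2) 0 1
  = RInt (fun z => Rmax 0 (up s z) ^ 2) 0 1
    + RInt (fun z => Rmax 0 (um s z) ^ 2) 0 1).
{ intros s; rewrite <- RInt_add by now apply I2.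
  apply RInt_ext; intros z; rewrite Rmin_left, Rmax_right by lra; intros Hz.
  specialize (Pl z ltac:(lra)).
  assert (N : Rmax 0 (up s z) * Rmax 0 (um s z) = 0).
  { destruct (Rle_dec 0 (u s z)).
    - rewrite (Rmax_left 0 (um s z)); [ring | unfold um; lra].
    - rewrite (Rmax_left 0 (up s z)); [ring | unfold up; lra]. }
  unfold w.
  replace ((Rmax 0 (up s z) + Rmax 0 (um s z)) ^ 2)
    with (Rmax 0 (up s z) ^ 2 + Rmax 0 (um s z) ^ 2
          + 2 * (Rmax 0 (up s z) * Rmax 0 (um s z))) by ring.
  rewrite N, Rmult_0_r; apply Rplus_0_r. }
assert (W0 : RInt (fun z => w 0 z ^ 2) 0 1 <= RInt (fun z => u 0 z ^ 2) 0 1).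
{ apply RInt_le; [lra | now apply I2 | now apply I2 | intros z Hz].
  specialize (Pl z ltac:(lra)).
  rewrite <- (pow2_abs (u 0 z)); apply pow_incr.
  unfold w, up, um, Rmax, Rabs.
  destruct (Rle_dec _ _), (Rle_dec _ _), (Rcase_abs _); lra. }
set (q := exp (- (a * PI ^ 2 * T))).
assert (Hq : 0 < q) by apply exp_pos.
assert (Q2 : exp (- (2 * a * PI ^ 2 * T)) = q ^ 2).
{ replace (q ^ 2) with (q * q) by ring.
  unfold q; rewrite <- exp_plus; f_equal; ring. }
rewrite Q2 in Dp, Dm.
assert (WT : RInt (fun z => w T z ^ 2) 0 1
             <= q ^ 2 * RInt (fun z => u 0 z ^ 2) 0 1).
{ rewrite W in W0 |- *.
  assert (0 <= q ^ 2) by apply pow2_ge_0.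
  apply Rle_trans with (q ^ 2 * (RInt (fun z => Rmax 0 (up 0 z) ^ 2) 0 1
                          + RInt (fun z => Rmax 0 (um 0 z) ^ 2) 0 1)).
  - lra.
  - now apply Rmult_le_compat_l. }
assert (U0 : 0 <= RInt (fun z => u 0 z ^ 2) 0 1)
  by (apply RInt_ge_0; [lra | now apply I2 | intros z _; apply pow2_ge_0]).
apply Rle_trans with (sqrt (RInt (fun z => (w T z + l z) ^ 2) 0 1)).
{ apply sqrt_le_1_alt, RInt_le; [lra | now apply I2 | | intros z Hz].
  - apply (I2 (fun z => w T z + l z)); intros z.
    now apply continuity_pt_plus.
  - specialize (Pl z ltac:(lra)).
    rewrite <- (pow2_abs (u T z)); apply pow_incr; split; [apply Rabs_pos | ].
    unfold w, up, um, Rmax, Rabs.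
    destruct (Rle_dec _ _), (Rle_dec _ _), (Rcase_abs _); lra. }
eapply Rle_trans; [now apply L2_triangle | ].
apply Rplus_le_compat; [ | now apply affine_L2].
rewrite <- (sqrt_pow2 q) by lra.
rewrite <- sqrt_mult by (try apply pow2_ge_0; easy).
now apply sqrt_le_1_alt.
Qed.

(** * The weighted maximum estimate *)

Lemma separated_caloric (a K sigma T theta phi : R) :
  a <> 0 -> sigma = a * phi ^ 2 ->
  caloric a (fun s z => K * exp (sigma * (T - s)) * sin (theta + z * phi))
    (fun s z => - sigma * (K * exp (sigma * (T - s)) * sin (theta + z * phi))).
Proof.
intros Ha Hs.
assert (C : forall s z, continuity_2d_pt
  (fun s z => K * exp (sigma * (T - s)) * sin (theta + z * phi)) s z).
{ intros s z; apply continuity_2d_pt_mult.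
  - apply (continuity_1d_2d_pt_comp (fun s => K * exp (sigma * (T - s)))
             (fun r _ => r)); [ | apply continuity_2d_pt_id1].
    eapply is_derive_continuity_pt; auto_derive; easy.
  - apply (continuity_1d_2d_pt_comp (fun z => sin (theta + z * phi))
             (fun _ y => y)); [ | apply continuity_2d_pt_id2].
    eapply is_derive_continuity_pt; auto_derive; easy. }
split; [exact C | split].
- intros s z _; split; [auto_derive; [easy | unfold Rminus; ring] | ].
  apply continuity_2d_pt_mult; [apply continuity_2d_pt_const | apply C].
- intros s _.
  exists (fun z => K * exp (sigma * (T - s)) * (phi * cos (theta + z * phi))).
  split.
  + intros z; eapply is_derive_continuity_pt; auto_derive; easy.
  + intros z _; split; auto_derive; try easy; [unfold Rminus; ring | ].
    rewrite Hs; unfold Rminus; field; easy.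
Qed.

(** Among the solutions [K exp (sigma (T - s)) sin (theta + z phi)] the one
    with [K sin (theta + phi)] the right-hand side of the estimate at time
    [T] is a barrier for [u] and [- u]: it dominates the boundary values at
    all earlier times since it decreases in time, and the initial values
    since that right-hand side is at least [exp (- sigma T) A]. *)
Lemma caloric_weighted_bound (a : R) (u ut : R -> R -> R)
    (sigma phi theta A M0 M1 T z : R) :
  0 < a -> 0 <= T -> caloric a u ut ->
  0 < phi -> sigma = a * phi ^ 2 -> 0 < theta < PI - phi ->
  (forall s, 0 <= s <= T -> Rabs (u s 0) <= M0) ->
  (forall s, 0 <= s <= T -> Rabs (u s 1) <= M1) ->
  (forall y, 0 <= y <= 1 ->
     sin (theta + phi) * Rabs (u 0 y) / sin (theta + y * phi) <= A) ->
  0 <= z <= 1 ->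
  sin (theta + phi) * Rabs (u T z) / sin (theta + z * phi)
    <= Rmax (exp (- (sigma * T)) * A)
         (Rmax (sin (theta + phi) / sin theta * M0) M1).
Proof.
intros Ha HT Hu Hphi Hsig Hth H0 H1 HA Hz.
set (B := Rmax (exp (- (sigma * T)) * A)
            (Rmax (sin (theta + phi) / sin theta * M0) M1)).
assert (BA : exp (- (sigma * T)) * A <= B) by apply Rmax_l.
assert (B0 : sin (theta + phi) / sin theta * M0 <= B)
  by (eapply Rle_trans; [ | apply Rmax_r]; apply Rmax_l).
assert (B1 : M1 <= B) by (eapply Rle_trans; [ | apply Rmax_r]; apply Rmax_r).
assert (Sp : forall y, 0 <= y <= 1 -> 0 < sin (theta + y * phi)).
{ intros y Hy; apply sin_gt_0; nra. }
assert (S1 : 0 < sin (theta + phi))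
  by (specialize (Sp 1 ltac:(lra)); now rewrite Rmult_1_l in Sp).
assert (S0 : 0 < sin theta)
  by (specialize (Sp 0 ltac:(lra)); now rewrite Rmult_0_l, Rplus_0_r in Sp).
assert (P1 : 0 <= M1) by (eapply Rle_trans; [apply Rabs_pos | apply (H1 0); lra]).
assert (Hs : 0 <= sigma) by (rewrite Hsig; apply Rmult_le_pos; [lra | apply pow2_ge_0]).
set (K := B / sin (theta + phi)).
assert (PK : 0 <= K) by (apply Rdiv_le_0_compat; lra).
assert (KB : K * sin (theta + phi) = B) by (unfold K; field; lra).
set (v := fun s z => K * exp (sigma * (T - s)) * sin (theta + z * phi)).
assert (Hv := separated_caloric a K sigma T theta phi (Rgt_not_eq _ _ Ha) Hsig).
fold v in Hv.
assert (Ev : forall s, 0 <= s <= T -> 1 <= exp (sigma * (T - s))).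
{ intros s Hsr; rewrite <- exp_0; apply exp_le_compat.
  apply Rmult_le_pos; lra. }
assert (V0 : forall s, 0 <= s <= T -> Rabs (u s 0) <= v s 0).
{ intros s Hsr; apply Rle_trans with (1 := H0 s Hsr).
  unfold v; rewrite Rmult_0_l, Rplus_0_r.
  apply Rle_trans with (K * sin theta).
  - apply (Rmult_le_reg_l (sin (theta + phi) / sin theta));
      [now apply Rdiv_lt_0_compat | ].
    replace (sin (theta + phi) / sin theta * (K * sin theta))
      with (K * sin (theta + phi)) by (field; lra).
    lra.
  - apply Rmult_le_compat_r; [lra | ].
    rewrite <- (Rmult_1_r K) at 1; apply Rmult_le_compat_l; auto. }
assert (V1 : forall s, 0 <= s <= T -> Rabs (u s 1) <= v s 1).
{ intros s Hsr; apply Rle_trans with (1 := H1 s Hsr).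
  unfold v; rewrite Rmult_1_l.
  apply Rle_trans with (K * sin (theta + phi)); [lra | ].
  apply Rmult_le_compat_r; [lra | ].
  rewrite <- (Rmult_1_r K) at 1; apply Rmult_le_compat_l; auto. }
assert (VI : forall y, 0 <= y <= 1 -> Rabs (u 0 y) <= v 0 y).
{ intros y Hy; specialize (Sp y Hy); specialize (HA y Hy).
  assert (E := exp_pos (sigma * T)).
  assert (Q : exp (sigma * T) * exp (- (sigma * T)) = 1).
  { rewrite <- exp_plus, <- exp_0; f_equal; ring. }
  assert (L : A <= exp (sigma * T) * B).
  { apply Rmult_le_compat_l with (r := exp (sigma * T)) in BA; [ | lra].
    rewrite <- Rmult_assoc, Q in BA; lra. }
  apply (Rmult_le_reg_l (sin (theta + phi) / sin (theta + y * phi)));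
    [now apply Rdiv_lt_0_compat | ].
  unfold v; rewrite Rminus_0_r.
  replace (sin (theta + phi) / sin (theta + y * phi)
           * (K * exp (sigma * T) * sin (theta + y * phi)))
    with (exp (sigma * T) * (K * sin (theta + phi))) by (field; lra).
  rewrite KB.
  replace (sin (theta + phi) / sin (theta + y * phi) * Rabs (u 0 y))
    with (sin (theta + phi) * Rabs (u 0 y) / sin (theta + y * phi))
    by (field; lra).
  lra. }
assert (Bar : Rabs (u T z) <= v T z).
{ apply Rabs_le; split.
  - assert (N := caloric_nonpos a _ _ T z Ha HT (caloric_lin a (-1) _ _ _ _ Hu Hv)).
    cbv beta in N.
    lapply N; [clear N; intros N | ].
    + lapply N; [clear N; intros N; specialize (N Hz); lra | ].
      intros y Hy; specialize (VI y Hy); apply Rabs_le_between in VI; lra.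
    + intros s Hsr; specialize (V0 s Hsr); specialize (V1 s Hsr).
      apply Rabs_le_between in V0; apply Rabs_le_between in V1; lra.
  - assert (N := caloric_nonpos a _ _ T z Ha HT (caloric_lin a 1 _ _ _ _ Hu Hv)).
    cbv beta in N.
    lapply N; [clear N; intros N | ].
    + lapply N; [clear N; intros N; specialize (N Hz); lra | ].
      intros y Hy; specialize (VI y Hy); apply Rabs_le_between in VI; lra.
    + intros s Hsr; specialize (V0 s Hsr); specialize (V1 s Hsr).
      apply Rabs_le_between in V0; apply Rabs_le_between in V1; lra. }
unfold v in Bar; rewrite Rminus_diag, Rmult_0_r, exp_0, Rmult_1_r in Bar.
specialize (Sp z Hz).
apply Rle_div_l; [lra | ].
rewrite <- KB.
apply Rmult_le_compat_l with (r := sin (theta + phi)) in Bar; lra.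
Qed.

(** * Transfer to the solutions of the boundary value problem *)

(** The rate [exp (- a PI ^ 2 t)] of the mean square estimate implies the
    weaker one of the theorem, since [q (2 - q) <= 1]. *)
Lemma le_sqrt_div_two_minus (q : R) :
  0 < q <= 1 -> q <= sqrt (q / (2 - q)).
Proof.
intros Hq; rewrite <- (sqrt_pow2 q) at 1 by lra.
apply sqrt_le_1_alt, (Rle_div_r (q ^ 2) q (2 - q)); [lra | ].
replace (q ^ 2 * (2 - q)) with (q * (1 - (1 - q) ^ 2)) by ring.
assert (0 <= (1 - q) ^ 2) by apply pow2_ge_0.
apply Rle_trans with (q * 1); [apply Rmult_le_compat_l | ]; lra.
Qed.

Theorem corollary2p5 (a : R) (ha : 0 < a)
    (x0 : R -> R) (hx0 : C2_unit x0)
    (d0 d1 : R -> R) (hd : Phi a x0 d0 d1)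
    (x : R -> R -> R) (hx : heat_solution a x0 d0 d1 x)
    (t : R) (ht : 0 <= t) :
  RInt (fun z => sin (PI * z) * Rabs (x t z)) 0 1
    <= exp (- (a * PI ^ 2 * t))
         * RInt (fun z => sin (PI * z) * Rabs (x 0 z)) 0 1
       + 1 / PI * (max_itv 0 t (fun s => Rabs (d0 s))
                   + max_itv 0 t (fun s => Rabs (d1 s)))
  /\
  sqrt (RInt (fun z => x t z ^ 2) 0 1)
    <= sqrt (exp (- (a * PI ^ 2 * t)) / (2 - exp (- (a * PI ^ 2 * t))))
         * sqrt (RInt (fun z => x 0 z ^ 2) 0 1)
       + 1 / sqrt 3 * (max_itv 0 t (fun s => Rabs (d0 s))
                       + max_itv 0 t (fun s => Rabs (d1 s)))
  /\
  forall sigma, 0 < sigma < a * PI ^ 2 ->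
  let phi := sqrt (sigma / a) in
  forall theta, 0 < theta < PI - phi ->
  max_itv 0 1
      (fun z => sin (theta + phi) * Rabs (x t z) / sin (theta + z * phi))
    <= Rmax
         (exp (- (sigma * t))
            * max_itv 0 1 (fun z =>
                sin (theta + phi) * Rabs (x 0 z) / sin (theta + z * phi)))
         (Rmax
            (sin (theta + phi) / sin theta
               * max_itv 0 t (fun s => Rabs (d0 s)))
            (max_itv 0 t (fun s => Rabs (d1 s)))).
Proof.
destruct (heat_solution_caloric a x0 d0 d1 x ha hx) as [ut Hu].
set (u := fun s z => x (Rmax 0 s) (clamp z)) in Hu.
assert (E : forall s z, 0 <= s -> 0 <= z <= 1 -> x s z = u s z).
{ intros s z Hs Hz; unfold u; rewrite Rmax_right by easy.
  now rewrite clamp_id. }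
assert (Hd0 : forall s, 0 <= s -> d0 s = u s 0).
{ intros s Hs; rewrite <- E by lra; symmetry; now apply hx. }
assert (Hd1 : forall s, 0 <= s -> d1 s = u s 1).
{ intros s Hs; rewrite <- E by lra; symmetry; now apply hx. }
assert (Cabs : forall f : R -> R, (forall z, continuity_pt f z) ->
          forall z, continuity_pt (fun y => Rabs (f y)) z).
{ intros f Cf z; apply (continuity_pt_comp f Rabs);
    [apply Cf | apply Rcontinuity_abs]. }
assert (Ct : forall z s, continuity_pt (fun s => u s z) s)
  by (intros z s; apply (continuity_2d_slice_l u), Hu).
assert (Cz : forall s z, continuity_pt (u s) z)
  by (intros s z; now apply (caloric_slice a u ut)).
assert (M0 : forall s, 0 <= s <= t ->
          Rabs (u s 0) <= max_itv 0 t (fun s => Rabs (d0 s))).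
{ intros s Hs; rewrite <- Hd0 by lra.
  apply (le_max_itv 0 t s (fun s => Rabs (d0 s)) (fun s => Rabs (u s 0)));
    [ | | easy].
  - intros z _; now apply (Cabs (fun s => u s 0)).
  - intros z Hz; now rewrite Hd0. }
assert (M1 : forall s, 0 <= s <= t ->
          Rabs (u s 1) <= max_itv 0 t (fun s => Rabs (d1 s))).
{ intros s Hs; rewrite <- Hd1 by lra.
  apply (le_max_itv 0 t s (fun s => Rabs (d1 s)) (fun s => Rabs (u s 1)));
    [ | | easy].
  - intros z _; now apply (Cabs (fun s => u s 1)).
  - intros z Hz; now rewrite Hd1. }
assert (EI : forall (F : R -> R -> R) s, 0 <= s ->
          RInt (fun z => F z (x s z)) 0 1 = RInt (fun z => F z (u s z)) 0 1).
{ intros F s Hs; apply RInt_ext; intros z.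
  rewrite Rmin_left, Rmax_right by lra; intros Hz; now rewrite E by lra. }
set (D0 := max_itv 0 t (fun s => Rabs (d0 s))) in *.
set (D1 := max_itv 0 t (fun s => Rabs (d1 s))) in *.
split; [ | split].
- rewrite !(EI (fun z y => sin (PI * z) * Rabs y)) by lra.
  now apply (sine_weighted_L1_decay a u ut).
- rewrite !(EI (fun z y => y ^ 2)) by lra.
  eapply Rle_trans; [now apply (caloric_L2_bound a u ut D0 D1) | ].
  apply Rplus_le_compat_r, Rmult_le_compat_r; [apply sqrt_pos | ].
  apply le_sqrt_div_two_minus; split; [apply exp_pos | ].
  rewrite <- exp_0; apply exp_le_compat.
  assert (0 <= a * PI ^ 2 * t); [ | lra].
  apply Rmult_le_pos; [apply Rmult_le_pos | ]; try lra; apply pow2_ge_0.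
- intros sigma Hsigma phi theta Htheta.
  assert (Hs : 0 < sigma / a) by (apply Rdiv_lt_0_compat; lra).
  assert (Hphi : 0 < phi) by now apply sqrt_lt_R0.
  assert (Hsp : sigma = a * phi ^ 2).
  { unfold phi; rewrite pow2_sqrt by lra; field; lra. }
  assert (Sp : forall y, 0 <= y <= 1 -> 0 < sin (theta + y * phi))
    by (intros y Hy; apply sin_gt_0; nra).
  apply max_itv_le; [lra | intros z Hz]; rewrite E by lra.
  apply (caloric_weighted_bound a u ut); try easy.
  intros y Hy; rewrite <- E by lra.
  apply (le_max_itv 0 1 y
    (fun z => sin (theta + phi) * Rabs (x 0 z) / sin (theta + z * phi))
    (fun z => sin (theta + phi) * Rabs (u 0 z) * / sin (theta + z * phi)));
    [ | | easy].
  + intros v Hv; specialize (Sp v Hv); apply continuity_pt_mult.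
    * apply continuity_pt_mult; [ | now apply (Cabs (u 0))].
      apply continuity_pt_const; now intros b c.
    * eapply is_derive_continuity_pt; auto_derive; [lra | reflexivity].
  + intros v Hv; rewrite E by lra; reflexivity.
Qed.
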